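(* Let $\{\mathcal G_k\}_{k=1}^\infty$ be a wide sequence. Let $F$ be a family of random variables on $\mathcal G_n$ with values in $\mathcal M_n$ which is $L_n$-closed and has restrictable ranges, and let $G$ be an $F$-compatible family of random functions on $\mathcal G_n$. Let the edge relation of the wide limit $\lim_F\mathcal G_n$ be represented in $G$ by $\Gamma$. Let $\varphi$ be an $\{E\}$-sentence, and let $\tilde\varphi(\Gamma)$ be the $L_n^2$-sentence obtained from $\varphi$ by replacing all occurrences of the relation symbol $E$ by $\Gamma$, keeping the structure of the logical connectives, and replacing all quantifiers $(\forall x)(\dots)$ by $(\forall x)(x<n\to(\dots))$ and $(\exists x)(\dots)$ by $(\exists x)(x<n\wedge\dots)$. Then $$\lim_F\mathcal G_n[\![\varphi]\!]=K(\mathcal G_n,F,G)[\![\tilde\varphi(\Gamma)]\!].$$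
   Context: Setup. $L_{all}$ is the first-order language with a name for every relation and function on $\mathbb N$. Fix an $\aleph_1$-saturated nonstandard model $\mathcal M$ of the true theory $\mathrm{Th}_{L_{all}}(\mathbb N)$, with $\mathbb N\subseteq\mathcal M$ as an initial segment, and a nonstandard number $n\in\mathcal M\setminus\mathbb N$. Finite sets, functions and sequences are coded by numbers; for a set $S$ coded in $\mathcal M$, $|S|\in\mathcal M$ is its (possibly nonstandard) cardinality. Any sequence of standard finite objects $\{a_k\}_k$ is given by a function symbol of $L_{all}$ and hence has a value $a_n\in\mathcal M$ at the nonstandard index $n$. $\mathbb Q^{\mathcal M}$ is the ordered field of fractions of elements of $\mathcal M$ and their negatives; $\mathrm{st}(q)\in\mathbb R$ is the standard part of a finite $q\in\mathbb Q^{\mathcal M}$; $q$ is infinitesimal if $|q|<1/k$ for all standard $k\ge1$. Wide sequence. A sequence $\{\mathcal G_k\}_{k=1}^\infty$ of finite sets of graphs (structures with one antireflexive symmetric binary relation $E$) such that every $\omega\in\mathcal G_k$ has vertex set $\{0,\dots,k-1\}$ and $\lim_{k\to\infty}|\mathcal G_k|=\infty$. $\mathcal G_n$ is the value of the sequence at index $n$; for $\omega\in\mathcal G_n$, $E_\omega$ is its edge relation. Boolean algebra. $\mathcal A$ is the Boolean algebra of all subsets of $\mathcal G_n$ coded by an element of $\mathcal M$; $\mathcal I$ is the ideal of those $A\in\mathcal A$ with $|A|/|\mathcal G_n|$ infinitesimal; $\mathcal B=\mathcal A/\mathcal I$. $\mathcal B$ is a complete Boolean algebra with greatest element $\mathbf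 1$, least element $\mathbf 0$, and measure $\mu(A/\mathcal I)=\mathrm{st}(|A|/|\mathcal G_n|)$. Family of random variables. A set $F$ of functions $\alpha:\mathcal G_n\to\mathcal M$, each coded by an element of $\mathcal M$. An $F$-vertex is an $\alpha\in F$ with $\alpha(\omega)\in\{0,\dots,n-1\}$ for all $\omega\in\mathcal G_n$; $U(F)$ is the set of $F$-vertices. Wide limit. $\lim_F\mathcal G_n$ is the $\mathcal B$-valued $\{E\}$-structure with universe $U(F)$ and truth values $[\![\alpha=\beta]\!]=\{\omega\in\mathcal G_n:\alpha(\omega)=\beta(\omega)\}/\mathcal I$, $[\![E(\alpha,\beta)]\!]=\{\omega\in\mathcal G_n:E_\omega(\alpha(\omega),\beta(\omega))\}/\mathcal I$; $[\![-]\!]$ commutes with $\neg,\wedge,\vee$; $[\![(\exists x)A(x)]\!]=\bigvee_{\alpha\in U(F)}[\![A(\alpha)]\!]$ and $[\![(\forall x)A(x)]\!]=\bigwedge_{\alpha\in U(F)}[\![A(\alpha)]\!]$. $\mathcal M_n$ and $L_n$. $\mathcal M_n\subseteq\mathcal M$ is the set of numbers bounded above by $2^{n^{1/t}}$ for some $t\in\mathcal M\setminus\mathbb N$. $L_n\subseteq L_{all}$ consists of all relation symbols of $L_{all}$ and all function symbols whose values on tuples from $\mathcal M_n$ lie in $\mathcal M_n$; $\mathcal M_n$ is regarded as an $L_n$-structure. $F$ is $L_n$-closed if for every $k$-ary function symbol $f\in L_n$ and $\alpha_0,\dots,\alpha_{k-1}\in F$, the function $\omega\mapsto f(\alpha_0(\omega),\dots,\alpha_{k-1}(\omega))$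 is in $F$. The language $L_n^2$ extends $L_n$ (number sort) by set-sort variables $X,Y,\dots$ standing for functions of any finite arity on the number sort, which can be applied to number terms to form number terms, and by equality for the set sort. An expression $X(x_0,\dots,x_{k-1})$ used as a formula abbreviates $X(x_0,\dots,x_{k-1})\ne0$. Random functions. A family of random functions on $\mathcal G_n$ is a set $G$ such that each $\Theta\in G$ has an arity $k\in\mathbb N$ and assigns to each $\omega\in\mathcal G_n$ a $k$-ary function $\Theta_\omega$, coded in $\mathcal M$, with values in $\mathcal M_n$ and with arguments from a domain $\mathrm{dom}(\Theta_\omega)$ of $k$-tuples of elements of $\mathcal M_n$. For $\alpha_0,\dots,\alpha_{k-1}\in F$, $\Theta(\alpha_0,\dots,\alpha_{k-1})$ is the function with value at $\omega$ equal to $\Theta_\omega(\alpha_0(\omega),\dots,\alpha_{k-1}(\omega))$ if this tuple is in $\mathrm{dom}(\Theta_\omega)$, and $0$ otherwise. $G$ is $F$-compatible if $\Theta(\alpha_0,\dots,\alpha_{k-1})\in F$ for all $k$-ary $\Theta\in G$ and all $\alpha_0,\dots,\alpha_{k-1}\in F$. The structure $K(\mathcal G_n,F,G)$. For $F$ $L_n$-closed with values in $\mathcal M_n$ and $G$ $F$-compatible, it is the $\mathcal B$-valued $L_n^2$-structure with number sort $F$ and set sort $G$ (terms are evaluated step by step to elements of $F$) and truth values: $[\![\alpha=\beta]\!]=\{\omega:\alpha(\omega)=\beta(\omega)\}/\mathcal I$; $[\![R(\alpha_0,\dots,\alpha_{k-1})]\!]=\{\omega:\mathcal M_n\models R(\alpha_0(\omega),\dots,\alpha_{k-1}(\omega))\}/\mathcal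 I$ for relation symbols $R\in L_n$; $[\![\Theta=\Xi]\!]=\{\omega:\Theta_\omega=\Xi_\omega\}/\mathcal I$; $[\![-]\!]$ commutes with $\neg,\wedge,\vee$; $\forall x,\exists x$ are interpreted by $\bigwedge_{\alpha\in F},\bigvee_{\alpha\in F}$, and $\forall X,\exists X$ by $\bigwedge_{\Theta\in G},\bigvee_{\Theta\in G}$. The symbol $n$ in a formula denotes the constant value $n$, i.e. $[\![\beta<n]\!]=\{\omega:\beta(\omega)<n\}/\mathcal I$. Representation. The edge relation of $\lim_F\mathcal G_n$ is represented in $G$ by $\Gamma$ if $\Gamma\in G$ is binary and $K(\mathcal G_n,F,G)[\![\Gamma(\alpha,\beta)]\!]=\lim_F\mathcal G_n[\![E(\alpha,\beta)]\!]$ for all $\alpha,\beta\in U(F)$. Restrictable ranges. $F$ has restrictable ranges if for every $\alpha\in F$ and $m\in\mathcal M_n$ there is $\tilde\alpha_m\in F$ with $\tilde\alpha_m(\omega)=\alpha(\omega)$ if $\alpha(\omega)<m$ and $\tilde\alpha_m(\omega)=0$ otherwise. *)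

(* Defs.v *)
From HB Require Import structures.
From mathcomp Require Import all_boot all_order generic_quotient finmap.
From mathcomp Require Import boolp classical_sets functions cardinality filter.
From Stdlib Require Reals.

Set Implicit Arguments.
Unset Strict Implicit.
Unset Printing Implicit Defensive.

Import Order.TTheory.

Local Open Scope classical_set_scope.
Local Open Scope quotient_scope.

(* First-order logic. Formulas are well scoped: [formula L m] has its free
   variables among the m de Bruijn indices 'I_m, a quantifier binds the index 0,
   and a sentence is an element of [formula L 0]. *)

Record language := Language { fsym : nat -> Type; rsym : nat -> Type }.

Inductive term (L : language) (m : nat) : Type :=
| Var (i : 'I_m)
| App (k : nat) (f : fsym L k) (t : 'I_k -> term L m).

Inductive formula (L : language) (m : nat) : Type :=
| fEq (t u : term L m)
| fRel (k : nat) (r : rsym L k) (t : 'I_k -> term L m)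
| fNot (p : formula L m)
| fAnd (p q : formula L m)
| fOr (p q : formula L m)
| fAll (p : formula L m.+1)
| fEx (p : formula L m.+1).

Record structure (L : language) := Structure {
  univ :> Type;
  fint : forall k, fsym L k -> ('I_k -> univ) -> univ;
  rint : forall k, rsym L k -> set ('I_k -> univ) }.

Definition scons (T : Type) (m : nat) (x : T) (e : 'I_m -> T) : 'I_m.+1 -> T :=
  fun i => oapp e x (unlift ord0 i).

Fixpoint teval (L : language) (S : structure L) m (t : term L m)
    (e : 'I_m -> S) : S :=
  match t with
  | Var i => e i
  | App k f u => fint f (fun i => teval (u i) e)
  end.

Fixpoint sat (L : language) (S : structure L) m (p : formula L m) :
    ('I_m -> S) -> Prop :=
  match p with
  | fEq t u => fun e => teval t e = teval u e
  | fRel k r t => fun e => rint r (fun i => teval (t i) e)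
  | fNot p => fun e => ~ sat p e
  | fAnd p q => fun e => sat p e /\ sat q e
  | fOr p q => fun e => sat p e \/ sat q e
  | fAll p => fun e => forall x : S, sat p (scons x e)
  | fEx p => fun e => exists x : S, sat p (scons x e)
  end.

(* A formula with one distinguished free variable (the index 0), the other free
   variables being replaced by parameters from S. *)
Record pformula (L : language) (S : structure L) := PFormula {
  pf_arity : nat;
  pf_formula : formula L pf_arity.+1;
  pf_params : 'I_pf_arity -> S }.

Definition pf_holds (L : language) (S : structure L) (q : pformula S) (x : S) :=
  sat (pf_formula q) (scons x (@pf_params _ _ q)).

Definition aleph1_saturated (L : language) (S : structure L) :=
  forall (A : set S) (p : set (pformula S)), countable A ->
    (forall q, p q -> forall i, A (@pf_params _ _ q i)) ->
    (forall p0, finite_set p0 -> p0 `<=` p ->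
       exists x, forall q, p0 q -> pf_holds q x) ->
  exists x, forall q, p q -> pf_holds q x.

Definition L_all : language :=
  Language (fun k => ('I_k -> nat) -> nat) (fun k => set ('I_k -> nat)).

Definition N_all : structure L_all :=
  @Structure L_all nat (fun k f => f) (fun k r => r).

Record true_model := TrueModel {
  tm_structure :> structure L_all;
  tm_true : forall p : formula L_all 0,
    sat (S := N_all) p (tnth [tuple]) -> sat (S := tm_structure) p (tnth [tuple]);
  tm_saturated : aleph1_saturated tm_structure }.

Section NamedSymbols.

Definition sym0 (c : nat) : fsym L_all 0 := fun=> c.
Definition sym1 (f : nat -> nat) : fsym L_all 1 := fun x => f (x ord0).
Definition sym2 (f : nat -> nat -> nat) : fsym L_all 2 :=
  fun x => f (x ord0) (x ord_max).
Definition rsym2 (r : nat -> nat -> Prop) : rsym L_all 2 :=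
  fun x => r (x ord0) (x ord_max).
Definition rsym3 (r : nat -> nat -> nat -> Prop) : rsym L_all 3 :=
  fun x => r (x ord0) (x (Ordinal (isT : 1 < 3))) (x ord_max).

Variable M : structure L_all.

Definition ap1 (f : nat -> nat) (x : M) : M := fint (sym1 f) (tnth [tuple x]).
Definition ap2 (f : nat -> nat -> nat) (x y : M) : M :=
  fint (sym2 f) (tnth [tuple x; y]).
Definition holds2 (r : nat -> nat -> Prop) (x y : M) : Prop :=
  rint (rsym2 r) (tnth [tuple x; y]).
Definition holds3 (r : nat -> nat -> nat -> Prop) (x y z : M) : Prop :=
  rint (rsym3 r) (tnth [tuple x; y; z]).

(* The value of the constant symbol k; the standard numbers form the initial
   segment of M which is identified with the natural numbers. *)
Definition std (k : nat) : M :=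
  fint (sym0 k) (tnth [tuple]).

Definition nonstandard (x : M) := forall k, x <> std k.

Definition Mlt : M -> M -> Prop := holds2 (fun x y => x < y).

End NamedSymbols.

Arguments std {M} k.

Record nonstd (M : structure L_all) :=
  Nonstd { ns_val :> M; ns_nonstandard : nonstandard ns_val }.

(* Codes. Finite sets, pairs and tuples of numbers are coded through their
   countType structure; numbers which are not codes are read as the empty set. *)

Definition decode (a : nat) : {fset nat} := odflt fset0 (choice.unpickle a).

Definition tuple_sym (k : nat) : fsym L_all k := fun x => choice.pickle (codom x).

Section Codes.

Variable M : structure L_all.

Definition Mmem : M -> M -> Prop := holds2 (fun x a => x \in decode a).
Definition Mcard : M -> M := ap1 (fun a => #|` decode a|).
Definition Mpair : M -> M -> M := ap2 (fun x y => choice.pickle (x, y)).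
Definition Mtuple (k : nat) (x : 'I_k -> M) : M :=
  fint (@tuple_sym k) x.

Definition ext (a : M) : set M := [set x | Mmem x a].
Definition coded (X : set M) := exists a, ext a = X.

(* A partial k-ary function is coded when its graph is. *)
Definition coded_function (k : nat) (f : ('I_k -> M) -> option M) :=
  coded [set z | exists x y, f x = Some y /\ z = Mpair (Mtuple x) y].

(* The quotient p / q is smaller than 1 / k for all standard k >= 1. *)
Definition infinitesimal_ratio (p q : M) :=
  forall k, 0 < k -> Mlt (ap2 muln (std k) p) q.

End Codes.

(* A graph with vertex set 'I_k is given by its set of (ordered) edges. *)
Definition simple_graph (k : nat) (E : {set 'I_k * 'I_k}) :=
  (forall i, (i, i) \notin E) /\ (forall i j, (i, j) \in E -> (j, i) \in E).

Record wide_sequence := WideSequence {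
  ws_graphs :> forall k, {set {set 'I_k * 'I_k}};
  ws_simple : forall k E, 0 < k -> E \in ws_graphs k -> simple_graph E;
  ws_wide : #|ws_graphs k| @[k --> \oo] --> \oo }.

Definition code_seq (s : seq nat) : nat := choice.pickle [fset x in s]%fset.
Definition graph_code (k : nat) (E : {set 'I_k * 'I_k}) : nat :=
  code_seq [seq choice.pickle (val p.1, val p.2) | p <- enum E].
Definition family_code (k : nat) (A : {set {set 'I_k * 'I_k}}) : nat :=
  code_seq [seq graph_code E | E <- enum A].

Lemma tnth1E (A B : Type) (h : A -> B) a :
  (fun i => h (tnth [tuple a] i)) = tnth [tuple h a].
Proof. by apply/funext => i; rewrite (ord1 i). Qed.

Lemma tnth2E (A B : Type) (h : A -> B) a b :
  (fun i => h (tnth [tuple a; b] i)) = tnth [tuple h a; h b].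
Proof. by apply/funext; case=> [[|[|//]] ?]. Qed.

Lemma transfer (M : true_model) m (p : formula L_all m) :
  (forall e, sat (S := N_all) p e) -> forall e, sat (S := M) p e.
Proof.
elim: m p => [|m IH] p hp e.
  have -> : e = tnth [tuple] by apply/funext => -[].
  exact: tm_true.
have -> : e = scons (e ord0) (fun i => e (lift ord0 i)).
  apply/funext => i; rewrite /scons; case: unliftP => [j ->|->] //=.
exact: (IH (fAll p) (fun e' x => hp (scons x e')) _ (e ord0)).
Qed.

Section FormulaSymbols.
Variable m : nat.
Implicit Types t u : term L_all m.

Definition tap1 f t := App (sym1 f) (tnth [tuple t]).
Definition tap2 f t u := App (sym2 f) (tnth [tuple t; u]).
Definition tstd k : term L_all m := App (sym0 k) (tnth [tuple]).
Definition fholds2 r t u := fRel (rsym2 r) (tnth [tuple t; u]).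
Definition fImp (p q : formula L_all m) := fOr (fNot p) q.

Variables (S : structure L_all) (e : 'I_m -> S).

Lemma teval1 f t : teval (tap1 f t) e = ap1 f (teval t e).
Proof. by rewrite /= (tnth1E (fun v => teval v e)). Qed.

Lemma teval2 f t u : teval (tap2 f t u) e = ap2 f (teval t e) (teval u e).
Proof. by rewrite /= (tnth2E (fun v => teval v e)). Qed.

Lemma teval_std k : teval (tstd k) e = std k.
Proof. by rewrite /std /=; congr fint; apply/funext => -[]. Qed.

Lemma sat_holds2 r t u :
  sat (fholds2 r t u) e = holds2 r (teval t e) (teval u e).
Proof. by rewrite /= (tnth2E (fun v => teval v e)). Qed.

Lemma sat_imp p q : sat (fImp p q) e = (sat p e -> sat q e) :> Prop.
Proof. by apply/propext => /=; rewrite -implyE. Qed.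

End FormulaSymbols.

Definition fset_op (f : {fset nat} -> {fset nat} -> {fset nat}) (a b : nat) :=
  choice.pickle (f (decode a) (decode b)).

Lemma pickleK_decode s : decode (choice.pickle s) = s.
Proof. by rewrite /decode choice.pickleK. Qed.

Lemma transferP (M : true_model) m (p : formula L_all m)
    (P : forall S : structure L_all, ('I_m -> S) -> Prop) :
  (forall S e, sat p e = P S e) -> (forall e, P N_all e) -> forall e, P M e.
Proof. by move=> pP hP e; rewrite -pP; apply: transfer => e'; rewrite pP. Qed.

(* An element of a which is not in b, if there is one. *)
Definition fset_sep (a b : nat) : nat := head 0 (enum_fset (fsetD (decode a) (decode b))).

Lemma sat_and (S : structure L_all) m (p q : formula L_all m) (e : 'I_m -> S) :
  sat (fAnd p q) e = (sat p e /\ sat q e).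
Proof. by []. Qed.

Lemma sat_or (S : structure L_all) m (p q : formula L_all m) (e : 'I_m -> S) :
  sat (fOr p q) e = (sat p e \/ sat q e).
Proof. by []. Qed.

Lemma sat_not (S : structure L_all) m (p : formula L_all m) (e : 'I_m -> S) :
  sat (fNot p) e = ~ sat p e.
Proof. by []. Qed.

Lemma teval_var (S : structure L_all) m (i : 'I_m) (e : 'I_m -> S) :
  teval (Var L_all i) e = e i.
Proof. by []. Qed.

Section TransferredFacts.
Variable M : true_model.
Implicit Types x a b c g : M.

Let satE := (sat_imp, sat_and, sat_or, sat_not, sat_holds2,
             teval1, teval2, teval_std, teval_var).

Let mem (y d : nat) : Prop := y \in decode d.
Let i0 : 'I_3 := ord0.
Let i1 : 'I_3 := Ordinal (isT : 1 < 3).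
Let i2 : 'I_3 := ord_max.
Let v i : term L_all 3 := Var L_all i.

Lemma ext_setU a b : ext (ap2 (fset_op fsetU) a b) = ext a `|` ext b.
Proof.
pose p := fholds2 mem (v i0) (tap2 (fset_op fsetU) (v i1) (v i2)).
pose q := fOr (fholds2 mem (v i0) (v i1)) (fholds2 mem (v i0) (v i2)).
apply/seteqP; split=> x.
- apply: (@transferP M _ (fImp p q) (fun S e =>
    Mmem (e i0) (ap2 (fset_op fsetU) (e i1) (e i2)) ->
    Mmem (e i0) (e i1) \/ Mmem (e i0) (e i2)) _ _ (tnth [tuple x; a; b])).
  + by move=> S e; rewrite !satE.
  + move=> e; change (e i0 \in decode (fset_op fsetU (e i1) (e i2)) ->
      e i0 \in decode (e i1) \/ e i0 \in decode (e i2)).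
    by rewrite pickleK_decode inE => /orP.
- apply: (@transferP M _ (fImp q p) (fun S e =>
    Mmem (e i0) (e i1) \/ Mmem (e i0) (e i2) ->
    Mmem (e i0) (ap2 (fset_op fsetU) (e i1) (e i2))) _ _ (tnth [tuple x; a; b])).
  + by move=> S e; rewrite !satE.
  + move=> e; change (e i0 \in decode (e i1) \/ e i0 \in decode (e i2) ->
      e i0 \in decode (fset_op fsetU (e i1) (e i2))).
    by rewrite pickleK_decode inE => /orP.
Qed.

Lemma ext_setD a b : ext (ap2 (fset_op fsetD) a b) = ext a `\` ext b.
Proof.
pose p := fholds2 mem (v i0) (tap2 (fset_op fsetD) (v i1) (v i2)).
pose q := fAnd (fholds2 mem (v i0) (v i1)) (fNot (fholds2 mem (v i0) (v i2))).
apply/seteqP; split=> x.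
- apply: (@transferP M _ (fImp p q) (fun S e =>
    Mmem (e i0) (ap2 (fset_op fsetD) (e i1) (e i2)) ->
    Mmem (e i0) (e i1) /\ ~ Mmem (e i0) (e i2)) _ _ (tnth [tuple x; a; b])).
  + by move=> S e; rewrite !satE.
  + move=> e; change (e i0 \in decode (fset_op fsetD (e i1) (e i2)) ->
      e i0 \in decode (e i1) /\ ~ e i0 \in decode (e i2)).
    by rewrite pickleK_decode inE => /andP[/negP].
- apply: (@transferP M _ (fImp q p) (fun S e =>
    Mmem (e i0) (e i1) /\ ~ Mmem (e i0) (e i2) ->
    Mmem (e i0) (ap2 (fset_op fsetD) (e i1) (e i2))) _ _ (tnth [tuple x; a; b])).
  + by move=> S e; rewrite !satE.
  + move=> e; change (e i0 \in decode (e i1) /\ ~ e i0 \in decode (e i2) ->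
      e i0 \in decode (fset_op fsetD (e i1) (e i2))).
    by rewrite pickleK_decode inE => -[-> /negP ->].
Qed.

Lemma card_setU_ratio a b g k :
  Mlt (ap2 muln (std (2 * k)) (Mcard a)) g ->
  Mlt (ap2 muln (std (2 * k)) (Mcard b)) g ->
  Mlt (ap2 muln (std k) (Mcard (ap2 (fset_op fsetU) a b))) g.
Proof.
pose lt (x y : nat) : Prop := x < y.
pose card (d : nat) := #|` decode d|.
pose f (l : nat) t := fholds2 lt (tap2 muln (tstd 3 l) (tap1 card t)) (v i2).
apply: (@transferP M _ (fImp (f (2 * k) (v i0)) (fImp (f (2 * k) (v i1))
    (f k (tap2 (fset_op fsetU) (v i0) (v i1))))) (fun S e =>
  Mlt (ap2 muln (std (2 * k)) (Mcard (e i0))) (e i2) ->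
  Mlt (ap2 muln (std (2 * k)) (Mcard (e i1))) (e i2) ->
  Mlt (ap2 muln (std k) (Mcard (ap2 (fset_op fsetU) (e i0) (e i1)))) (e i2))
  _ _ (tnth [tuple a; b; g])).
  by move=> S e; rewrite !satE.
move=> e; change (2 * k * card (e i0) < e i2 -> 2 * k * card (e i1) < e i2 ->
  k * card (fset_op fsetU (e i0) (e i1)) < e i2).
rewrite /card pickleK_decode => ha hb.
have hU : #|` fsetU (decode (e i0)) (decode (e i1))| <=
    #|` decode (e i0)| + #|` decode (e i1)|.
  by rewrite -cardfsUI leq_addr.
rewrite -(ltn_pmul2l (isT : 0 < 2)); apply: (leq_ltn_trans (n := 2 * k *
  (#|` decode (e i0)| + #|` decode (e i1)|))).
  by rewrite mulnA leq_mul2l hU orbT.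
by rewrite mulnDr (mul2n (e i2)) -addnn -addSn leq_add // ltnW.
Qed.

Lemma card_sub_ratio a b g k : ext a `<=` ext b ->
  Mlt (ap2 muln (std k) (Mcard b)) g -> Mlt (ap2 muln (std k) (Mcard a)) g.
Proof.
pose lt (x y : nat) : Prop := x < y.
pose card (d : nat) := #|` decode d|.
pose f t := fholds2 lt (tap2 muln (tstd 3 k) (tap1 card t)) (v i2).
pose s := tap2 fset_sep (v i0) (v i1).
move=> sab; apply: (@transferP M _ (fImp (fImp (fholds2 mem s (v i0))
    (fholds2 mem s (v i1))) (fImp (f (v i1)) (f (v i0)))) (fun S e =>
  (Mmem (ap2 fset_sep (e i0) (e i1)) (e i0) ->
   Mmem (ap2 fset_sep (e i0) (e i1)) (e i1)) ->
  Mlt (ap2 muln (std k) (Mcard (e i1))) (e i2) ->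
  Mlt (ap2 muln (std k) (Mcard (e i0))) (e i2)) _ _ (tnth [tuple a; b; g])).
- by move=> S e; rewrite !satE.
- move=> e; change ((fset_sep (e i0) (e i1) \in decode (e i0) ->
    fset_sep (e i0) (e i1) \in decode (e i1)) -> k * card (e i1) < e i2 ->
    k * card (e i0) < e i2).
  move=> h; apply: leq_ltn_trans; rewrite leq_mul2l; apply/orP; right.
  apply: fsubset_leq_card; rewrite -fsetD_eq0; apply/eqP.
  move: h; rewrite /fset_sep; set d := fsetD _ _.
  have hd (y : nat) : y \in d = (y \in decode (e i0)) && (y \notin decode (e i1)).
    by rewrite in_fsetD andbC.
  case E : (enum_fset d) => [|z t] /= h.
    by apply/fsetP => y; rewrite in_fset0 -[LHS]/(y \in enum_fset d) E.
  have : z \in d by rewrite -[_ \in _]/(z \in enum_fset d) E mem_head.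
  by rewrite hd => /andP[/h ->].
- exact: sab.
Qed.

Lemma ext0 : ext (std (choice.pickle (fset0 : {fset nat})) : M) = set0.
Proof.
apply/seteqP; split=> // x; pose c := choice.pickle (fset0 : {fset nat}).
apply: (@transferP M _ (fNot (fholds2 mem (v i0) (tstd 3 c))) (fun S e =>
  ~ Mmem (e i0) (std c)) _ _ (tnth [tuple x; x; x])).
  by move=> S e; rewrite !satE.
by move=> e; change (~ e i0 \in decode c); rewrite pickleK_decode.
Qed.

Lemma card0_ratio g k : Mlt (std 0) g ->
  Mlt (ap2 muln (std k) (Mcard (std (choice.pickle (fset0 : {fset nat}))))) g.
Proof.
pose c := choice.pickle (fset0 : {fset nat}).
pose lt (x y : nat) : Prop := x < y.
pose card (d : nat) := #|` decode d|.
apply: (@transferP M _ (fImp (fholds2 lt (tstd 3 0) (v i0))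
   (fholds2 lt (tap2 muln (tstd 3 k) (tap1 card (tstd 3 c))) (v i0))) (fun S e =>
  Mlt (std 0) (e i0) -> Mlt (ap2 muln (std k) (Mcard (std c))) (e i0)) _ _
  (tnth [tuple g; g; g])).
  by move=> S e; rewrite !satE.
move=> e; change (0 < e i0 -> k * card c < e i0).
by rewrite /card pickleK_decode cardfs0 muln0.
Qed.

Lemma nonstandard_gt x k : nonstandard x -> ~ Mlt x (std k).
Proof.
pose lt (x y : nat) : Prop := x < y.
move=> nx; elim: k => [|k IH].
  apply: (@transferP M _ (fNot (fholds2 lt (v i0) (tstd 3 0))) (fun S e =>
    ~ Mlt (e i0) (std 0)) _ _ (tnth [tuple x; x; x])).
    by move=> S e; rewrite !satE.
  by [].
move=> hx; suff: Mlt x (std k) \/ x = std k by case=> [/IH|/nx].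
move: hx; apply: (@transferP M _ (fImp (fholds2 lt (v i0) (tstd 3 k.+1))
    (fOr (fholds2 lt (v i0) (tstd 3 k)) (fEq (v i0) (tstd 3 k)))) (fun S e =>
  Mlt (e i0) (std k.+1) -> Mlt (e i0) (std k) \/ e i0 = std k) _ _
  (tnth [tuple x; x; x])).
  by move=> S e; rewrite !satE /sat !satE.
move=> e; change (e i0 < k.+1 -> e i0 < k \/ e i0 = k).
by rewrite ltnS leq_eqVlt => /orP[/eqP|]; [right|left].
Qed.

Lemma card_family_gt0 (G : wide_sequence) x : nonstandard x ->
  Mlt (std 0) (Mcard (ap1 (fun k => family_code (G k)) x)).
Proof.
pose lt (x y : nat) : Prop := x < y.
pose card (d : nat) := #|` decode d|.
pose gc k := family_code (G k).
move=> nx; have [K _ hK] : exists2 K, True & forall k, K <= k -> 0 < #|G k|.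
  have /(_ [set n | 0 < n]) := @ws_wide G.
  case; first by exists 1.
  by move=> K _ hK; exists K => // k /hK.
suff: Mlt (std 0) (Mcard (ap1 gc x)) \/ Mlt x (std K).
  by case=> // /(nonstandard_gt nx).
apply: (@transferP M _ (fOr (fholds2 lt (tstd 3 0) (tap1 card (tap1 gc (v i0))))
   (fholds2 lt (v i0) (tstd 3 K))) (fun S e =>
  Mlt (std 0) (Mcard (ap1 gc (e i0))) \/ Mlt (e i0) (std K)) _ _
  (tnth [tuple x; x; x])).
  by move=> S e; rewrite !satE.
move=> e; change (0 < card (gc (e i0)) \/ e i0 < K).
have [/hK|] := leqP K (e i0); last by right.
case/card_gt0P => E hE; left; rewrite /card /gc pickleK_decode cardfs_gt0.
by apply/fset0Pn; exists (graph_code E); rewrite inE map_f // mem_enum.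
Qed.

End TransferredFacts.

Section BooleanAlgebra.
Variables (M : true_model) (n : nonstd M) (G : wide_sequence).

Definition Gcode : M := ap1 (fun k => family_code (G k)) n.
Definition Gn : set M := ext Gcode.

(* The edge relation of a graph coded in M. *)
Definition edge (w : Gn) (x y : M) := Mmem (Mpair x y) (set_val w).

Definition Gcoded (X : set Gn) := coded (set_val @` X).

Record coded_subset := CodedSubset {
  cs_set :> set Gn;
  cs_coded : Gcoded cs_set }.

HB.instance Definition _ := gen_eqMixin coded_subset.
HB.instance Definition _ := gen_choiceMixin coded_subset.

(* The ideal of the sets A such that |A| / |Gn| is infinitesimal. *)
Definition negligible (X : set Gn) :=
  exists a, ext a = set_val @` X /\ infinitesimal_ratio (Mcard a) (Mcard Gcode).

Lemma val_image_setD (X Y : set Gn) :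
  set_val @` (X `\` Y) = (set_val @` X) `\` (set_val @` Y) :> set M.
Proof.
apply/seteqP; split=> [_ [w [Xw nYw] <-]|_ [[w Xw <-]] h].
  by split; [exists w|case=> u Yu /val_inj uw; apply: nYw; rewrite -uw].
by exists w => //; split=> // Yw; apply: h; exists w.
Qed.

Lemma Gcoded0 : Gcoded set0.
Proof. by rewrite /Gcoded image_set0; exists (std (choice.pickle (fset0 : {fset nat}))); apply: ext0. Qed.

Lemma GcodedT : Gcoded setT.
Proof.
exists Gcode; apply/seteqP; split=> [x xG|_ [w _ <-]]; last exact: (set_valP w).
by exists (SigSub (mem_set xG)).
Qed.

Lemma GcodedU X Y : Gcoded X -> Gcoded Y -> Gcoded (X `|` Y).
Proof.
case=> a aX [b bY]; exists (ap2 (fset_op fsetU) a b).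
by rewrite ext_setU aX bY image_setU.
Qed.

Lemma GcodedD X Y : Gcoded X -> Gcoded Y -> Gcoded (X `\` Y).
Proof.
case=> a aX [b bY]; exists (ap2 (fset_op fsetD) a b).
by rewrite ext_setD aX bY val_image_setD.
Qed.

Lemma GcodedC X : Gcoded X -> Gcoded (~` X).
Proof. by rewrite -setTD; apply: GcodedD; apply: GcodedT. Qed.

Lemma GcodedI X Y : Gcoded X -> Gcoded Y -> Gcoded (X `&` Y).
Proof. by move=> hX hY; rewrite -setDD; do 2!apply: GcodedD => //. Qed.

Lemma GcodedY X Y : Gcoded X -> Gcoded Y -> Gcoded (X `+` Y).
Proof. by move=> hX hY; apply: GcodedU; apply: GcodedD. Qed.

Lemma negligible0 : negligible set0.
Proof.
exists (std (choice.pickle (fset0 : {fset nat}))).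
rewrite image_set0 ext0; split=> // k _.
exact/card0_ratio/card_family_gt0/ns_nonstandard.
Qed.

Lemma negligibleU X Y : negligible X -> negligible Y -> negligible (X `|` Y).
Proof.
case=> a [aX ha] [b [bY hb]]; exists (ap2 (fset_op fsetU) a b).
rewrite ext_setU aX bY image_setU; split=> // k k0.
by apply: card_setU_ratio; [apply: ha|apply: hb]; rewrite muln_gt0.
Qed.

Lemma negligible_sub X Y : Gcoded X -> X `<=` Y -> negligible Y -> negligible X.
Proof.
move=> [a aX] XY [b [bY hb]]; exists a; split=> // k k0.
by apply: card_sub_ratio (hb k k0); rewrite aX bY; apply: image_subset.
Qed.

Definition cs_eq (X Y : coded_subset) := `[< negligible (X `+` Y) >].

Lemma cs_eq_sym : symmetric cs_eq.
Proof. by move=> X Y; rewrite /cs_eq setYC. Qed.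

Lemma cs_eq_refl : reflexive cs_eq.
Proof. by move=> X; apply/asboolP; rewrite setYK; apply: negligible0. Qed.

Lemma cs_eq_trans : transitive cs_eq.
Proof.
move=> Y X Z /asboolP XY /asboolP YZ; apply/asboolP.
apply: negligible_sub (negligibleU XY YZ).
  by apply: GcodedY; apply: cs_coded.
move=> w [[Xw nZw]|[Zw nXw]]; case: (pselect (cs_set Y w)) => Yw.
- by right; left.
- by left; left.
- by left; right.
- by right; right.
Qed.

Canonical cs_equiv := EquivRel cs_eq cs_eq_refl cs_eq_sym cs_eq_trans.

Definition BG := {eq_quot cs_eq}.
HB.instance Definition _ := Choice.on BG.
HB.instance Definition _ := EqQuotient.on BG.

Definition csI (X Y : coded_subset) :=
  CodedSubset (GcodedI (cs_coded X) (cs_coded Y)).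
Definition csU (X Y : coded_subset) :=
  CodedSubset (GcodedU (cs_coded X) (cs_coded Y)).
Definition csC (X : coded_subset) := CodedSubset (GcodedC (cs_coded X)).

Definition bmeet : BG -> BG -> BG := lift_op2 BG csI.
Definition bjoin : BG -> BG -> BG := lift_op2 BG csU.
Definition bcompl : BG -> BG := lift_op1 BG csC.

Lemma cs_eqP (X Y : coded_subset) :
  reflect (negligible (cs_set X `+` cs_set Y)) (X == Y %[mod BG]).
Proof. by rewrite eqmodE; apply: (iffP (asboolP _)). Qed.

Lemma repr_eq (X : coded_subset) :
  negligible (cs_set (repr (\pi_BG X)) `+` cs_set X).
Proof. by apply/cs_eqP; rewrite reprK. Qed.

(* An operation on sets whose results differ only where its arguments do
   respects the ideal. *)
Lemma cs_eq_op (X X' Y Y' U V : coded_subset) :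
  negligible (cs_set X `+` cs_set X') -> negligible (cs_set Y `+` cs_set Y') ->
  cs_set U `+` cs_set V `<=`
    (cs_set X `+` cs_set X') `|` (cs_set Y `+` cs_set Y') ->
  \pi_BG U = \pi_BG V.
Proof.
move=> hX hY sUV; apply/eqP/cs_eqP; apply: negligible_sub (negligibleU hX hY) => //.
by apply: GcodedY; apply: cs_coded.
Qed.

Lemma pi_bmeet : {morph \pi_BG : X Y / csI X Y >-> bmeet X Y}.
Proof.
move=> X Y; unlock bmeet; apply/esym; apply: cs_eq_op (repr_eq X) (repr_eq Y) _.
by move=> w /=; rewrite /setY /setD /setU /setI /=; tauto.
Qed.

Lemma pi_bjoin : {morph \pi_BG : X Y / csU X Y >-> bjoin X Y}.
Proof.
move=> X Y; unlock bjoin; apply/esym; apply: cs_eq_op (repr_eq X) (repr_eq Y) _.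
by move=> w /=; rewrite /setY /setD /setU /setI /=; tauto.
Qed.

Lemma pi_bcompl : {morph \pi_BG : X / csC X >-> bcompl X}.
Proof.
move=> X; unlock bcompl; apply/esym; apply: cs_eq_op (repr_eq X) (repr_eq X) _.
move=> w /=; rewrite /setY /setD /setU /setI /setC /= => -[[h1 h2]|[h1 h2]].
  by left; right; split=> //; apply: contrapT.
by left; left; split=> //; apply: contrapT.
Qed.

Lemma cs_setP (X Y : coded_subset) : cs_set X = cs_set Y -> X = Y.
Proof. by case: X Y => X cX [Y cY] /= XY; subst Y; congr CodedSubset. Qed.

Definition ble (b c : BG) := bmeet b c == b.
Definition blt (b c : BG) := (c != b) && ble b c.

Lemma bmeetC : commutative bmeet.
Proof.
elim/quotW => X; elim/quotW => Y; rewrite -!pi_bmeet; congr (\pi_BG _).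
by apply: cs_setP; apply: setIC.
Qed.

Lemma bjoinC : commutative bjoin.
Proof.
elim/quotW => X; elim/quotW => Y; rewrite -!pi_bjoin; congr (\pi_BG _).
by apply: cs_setP; apply: setUC.
Qed.

Lemma bmeetA : associative bmeet.
Proof.
elim/quotW => X; elim/quotW => Y; elim/quotW => Z.
by rewrite -!pi_bmeet; congr (\pi_BG _); apply: cs_setP; apply: setIA.
Qed.

Lemma bjoinA : associative bjoin.
Proof.
elim/quotW => X; elim/quotW => Y; elim/quotW => Z.
by rewrite -!pi_bjoin; congr (\pi_BG _); apply: cs_setP; apply: setUA.
Qed.

Lemma bjoinKI (c b : BG) : bmeet b (bjoin b c) = b.
Proof.
elim/quotW: b => X; elim/quotW: c => Y.
by rewrite -pi_bjoin -pi_bmeet; congr (\pi_BG _); apply: cs_setP; rewrite /= setUC setKU.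
Qed.

Lemma bmeetKU (c b : BG) : bjoin b (bmeet b c) = b.
Proof.
elim/quotW: b => X; elim/quotW: c => Y.
by rewrite -pi_bmeet -pi_bjoin; congr (\pi_BG _); apply: cs_setP; rewrite /= setIC setKI.
Qed.

Lemma bmeetUl : left_distributive bmeet bjoin.
Proof.
elim/quotW => X; elim/quotW => Y; elim/quotW => Z.
rewrite -pi_bjoin -!pi_bmeet -pi_bjoin; congr (\pi_BG _).
by apply: cs_setP; apply: setIUl.
Qed.

Lemma bmeetxx : idempotent_op bmeet.
Proof.
elim/quotW => X; rewrite -pi_bmeet; congr (\pi_BG _).
by apply: cs_setP; apply: setIid.
Qed.

Fact BG_display : Order.disp_t. Proof. exact: Order.Disp tt tt. Qed.

HB.instance Definition _ := Order.isMeetJoinDistrLattice.Build BG_display BG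
  (fun b c => erefl : ble b c = (bmeet b c == b)) (fun b c => erefl : blt b c = _)
  bmeetC bjoinC bmeetA bjoinA bjoinKI bmeetKU bmeetUl bmeetxx.

Definition cs0 := CodedSubset Gcoded0.
Definition csT := CodedSubset GcodedT.

Lemma ble0x (b : BG) : (\pi_BG cs0 <= b)%O.
Proof.
elim/quotW: b => X; apply/eqP; rewrite -[LHS]/(bmeet _ _) -pi_bmeet.
by congr (\pi_BG _); apply: cs_setP; apply: set0I.
Qed.

Lemma blex1 (b : BG) : (b <= \pi_BG csT)%O.
Proof.
elim/quotW: b => X; apply/eqP; rewrite -[LHS]/(bmeet _ _) -pi_bmeet.
by congr (\pi_BG _); apply: cs_setP; apply: setIT.
Qed.

HB.instance Definition _ := Order.hasBottom.Build BG_display BG ble0x.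
HB.instance Definition _ := Order.hasTop.Build BG_display BG blex1.

Lemma bjoinxC (b : BG) : (b `|` bcompl b = \top)%O.
Proof.
elim/quotW: b => X; rewrite -[LHS]/(bjoin _ _) -pi_bcompl -pi_bjoin.
by congr (\pi_BG _); apply: cs_setP; apply: setUCr.
Qed.

Lemma bmeetxC (b : BG) : (b `&` bcompl b = \bot)%O.
Proof.
elim/quotW: b => X; rewrite -[LHS]/(bmeet _ _) -pi_bcompl -pi_bmeet.
by congr (\pi_BG _); apply: cs_setP; apply: setICr.
Qed.

HB.instance Definition _ := Order.TBDistrLattice_hasComplement.Build
  BG_display BG bjoinxC bmeetxC.

End BooleanAlgebra.

Section Mn.
Variables (M : true_model) (n : nonstd M).

(* x <= 2 ^ (n ^ (1 / t)), with real exponents; L_all names every relation. *)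
Definition le_pow_root (x n t : nat) : Prop :=
  Rdefinitions.Rle (Raxioms.INR x)
    (Rpower.Rpower (Raxioms.INR 2)
      (Rpower.Rpower (Raxioms.INR n) (Rdefinitions.Rinv (Raxioms.INR t)))).

Definition Mn (x : M) := exists t : M, nonstandard t /\ holds3 le_pow_root x n t.

Lemma Mn0 : Mn (std 0).
Proof.
exists n; split; first exact: ns_nonstandard.
pose v0 : term L_all 1 := Var L_all ord0.
apply: (@transferP M _ (fRel (rsym3 le_pow_root) (tnth [tuple tstd 1 0; v0; v0]))
  (fun S e => holds3 le_pow_root (std 0) (e ord0) (e ord0)) _ _ (tnth [tuple n : M])).
  move=> S e /=; congr (rint _ _); apply/funext; case=> [[|[|[|//]]] ?] //=.
  exact: teval_std.
by move=> e; apply/RIneq.Rlt_le/Exp_prop.exp_pos.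
Qed.

Definition Ln_closed_symbol (k : nat) (f : fsym L_all k) :=
  forall x : 'I_k -> M, (forall i, Mn (x i)) -> Mn (fint f x).

Definition Ln : language :=
  Language (fun k => {f : fsym L_all k | Ln_closed_symbol f}) (rsym L_all).

Lemma Ln_closed_zero : Ln_closed_symbol (sym0 0).
Proof.
move=> x _; suff -> : x = tnth [tuple] by exact: Mn0.
by apply/funext => -[].
Qed.

Definition Ln_zero : fsym Ln 0 := exist _ (sym0 0) Ln_closed_zero.
Definition Ln_lt : rsym Ln 2 := rsym2 (fun x y => x < y).

End Mn.

(* Well-scoped formulas of the two-sorted language over L, in the style of
   [formula]: m counts the free number variables, and D lists the arities of the
   free set variables (de Bruijn indices in D are the elements of [svar D]).
   The symbol n of the number sort is [kn]. *)

Inductive svar : seq nat -> nat -> Type :=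
| sv0 k D : svar (k :: D) k
| svS k l D (X : svar D k) : svar (l :: D) k.

Inductive kterm (L : language) (m : nat) (D : seq nat) : Type :=
| kVar (i : 'I_m)
| kn
| kApp (k : nat) (f : fsym L k) (t : 'I_k -> kterm L m D)
| kSet (k : nat) (X : svar D k) (t : 'I_k -> kterm L m D).

Inductive kformula (L : language) (m : nat) (D : seq nat) : Type :=
| kEq (t u : kterm L m D)
| kRel (k : nat) (r : rsym L k) (t : 'I_k -> kterm L m D)
| kEqS (k : nat) (X Y : svar D k)
| kNot (p : kformula L m D)
| kAnd (p q : kformula L m D)
| kOr (p q : kformula L m D)
| kAll (p : kformula L m.+1 D)
| kEx (p : kformula L m.+1 D)
| kAllS (k : nat) (p : kformula L m (k :: D))
| kExS (k : nat) (p : kformula L m (k :: D)).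

Definition kImp (L : language) m D (p q : kformula L m D) := kOr (kNot p) q.

Fixpoint senv (T : nat -> Type) (D : seq nat) : Type :=
  if D is k :: D' then (T k * senv T D')%type else unit.

Fixpoint slookup (T : nat -> Type) D k (X : svar D k) : senv T D -> T k :=
  match X with
  | sv0 _ _ => fun s => s.1
  | svS _ _ _ X => fun s => slookup X s.2
  end.

(* Formulas of the language {E}, with the same conventions; the only terms of
   this language are variables. *)
Inductive gformula (m : nat) : Type :=
| gEq (i j : 'I_m)
| gE (i j : 'I_m)
| gNot (p : gformula m)
| gAnd (p q : gformula m)
| gOr (p q : gformula m)
| gAll (p : gformula m.+1)
| gEx (p : gformula m.+1).

Section Structures.
Variables (M : true_model) (n : nonstd M) (G : wide_sequence).

Let Om : Type := Gn n G.

(* The class of a subset of Gn modulo the ideal. All sets arising from atomic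
   formulas of the number sort are coded in M; \bot is only a default value. *)
Definition cls (X : set Om) : BG n G :=
  if pselect (Gcoded X) is left cX then \pi_(BG n G) (CodedSubset cX)
  else \bot%O.

(* Joins and meets of arbitrary subsets; they exist because M is saturated. *)
Definition bigjoin (A : set (BG n G)) : BG n G := supremum \bot%O A.
Definition bigmeet (A : set (BG n G)) : BG n G := infimum \top%O A.

Definition random_variable (a : Om -> M) :=
  coded [set z | exists w : Om, z = Mpair (set_val w) (a w)].

Definition rv_family (F : set (Om -> M)) := F `<=` random_variable.

Definition values_in_Mn (F : set (Om -> M)) :=
  forall a, F a -> forall w, Mn n (a w).

Definition Ln_closed (F : set (Om -> M)) :=
  forall k (f : fsym (Ln n) k) (a : 'I_k -> Om -> M), (forall i, F (a i)) ->
    F (fun w => fint (sval f) (fun i => a i w)).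

Definition restrictable_ranges (F : set (Om -> M)) :=
  forall a m, F a -> Mn n m -> exists2 b, F b &
    forall w, (Mlt (a w) m -> b w = a w) /\ (~ Mlt (a w) m -> b w = std 0).

Definition vertices (F : set (Om -> M)) : set (Om -> M) :=
  [set a | F a /\ forall w, Mlt (a w) n].

(* Partial k-ary functions on M, one for each sample. *)
Definition rfun (k : nat) := Om -> ('I_k -> M) -> option M.

Definition random_function (k : nat) (T : rfun k) :=
  forall w, coded_function (T w) /\
    forall x y, T w x = Some y -> (forall i, Mn n (x i)) /\ Mn n y.

Definition rfun_family (GG : forall k, set (rfun k)) :=
  forall k, GG k `<=` @random_function k.

Definition rapp (k : nat) (T : rfun k) (a : 'I_k -> Om -> M) : Om -> M :=
  fun w => odflt (std 0) (T w (fun i => a i w)).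

Definition compatible (F : set (Om -> M)) (GG : forall k, set (rfun k)) :=
  forall k (T : rfun k) (a : 'I_k -> Om -> M),
    GG k T -> (forall i, F (a i)) -> F (rapp T a).

(* Truth values in the wide limit. *)
Fixpoint wlim (F : set (Om -> M)) m (p : gformula m) :
    ('I_m -> Om -> M) -> BG n G :=
  match p with
  | gEq i j => fun e => cls [set w | e i w = e j w]
  | gE i j => fun e => cls [set w | edge w (e i w) (e j w)]
  | gNot p => fun e => (~` wlim F p e)%O
  | gAnd p q => fun e => (wlim F p e `&` wlim F q e)%O
  | gOr p q => fun e => (wlim F p e `|` wlim F q e)%O
  | gAll p => fun e => bigmeet [set wlim F p (scons a e) | a in vertices F]
  | gEx p => fun e => bigjoin [set wlim F p (scons a e) | a in vertices F]
  end.

Fixpoint keval m D (t : kterm (Ln n) m D) (e : 'I_m -> Om -> M)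
    (s : senv rfun D) : Om -> M :=
  match t with
  | kVar i => e i
  | kn => fun=> n
  | kApp k f u => fun w => fint (sval f) (fun i => keval (u i) e s w)
  | kSet k X u => rapp (slookup X s) (fun i => keval (u i) e s)
  end.

(* Truth values in K(Gn, F, GG); a quantifier over set variables of arity k
   ranges over the k-ary elements of GG. Relation symbols are evaluated in M, of which
   Mn is a substructure. *)
Fixpoint ktruth (F : set (Om -> M)) (GG : forall k, set (rfun k)) m D
    (p : kformula (Ln n) m D) : ('I_m -> Om -> M) -> senv rfun D -> BG n G :=
  match p with
  | kEq t u => fun e s => cls [set w | keval t e s w = keval u e s w]
  | kRel k r t => fun e s =>
      cls [set w | rint (s := M) r (fun i => keval (t i) e s w)]
  | kEqS k X Y => fun e s => cls [set w | slookup X s w = slookup Y s w]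
  | kNot p => fun e s => (~` ktruth F GG p e s)%O
  | kAnd p q => fun e s => (ktruth F GG p e s `&` ktruth F GG q e s)%O
  | kOr p q => fun e s => (ktruth F GG p e s `|` ktruth F GG q e s)%O
  | kAll p => fun e s => bigmeet [set ktruth F GG p (scons a e) s | a in F]
  | kEx p => fun e s => bigjoin [set ktruth F GG p (scons a e) s | a in F]
  | kAllS k p => fun e s =>
      bigmeet [set ktruth F GG p e ((T, s) : senv rfun (k :: _)) | T in GG k]
  | kExS k p => fun e s =>
      bigjoin [set ktruth F GG p e ((T, s) : senv rfun (k :: _)) | T in GG k]
  end.

(* The atomic formula X(t, u), which abbreviates X(t, u) <> 0. *)
Definition kAtom m D (X : svar D 2) (t u : kterm (Ln n) m D) :=
  kNot (kEq (kSet X (tnth [tuple t; u])) (kApp (Ln_zero n) (tnth [tuple]))).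

Definition klt m D (t u : kterm (Ln n) m D) :=
  kRel (Ln_lt n) (tnth [tuple t; u]).

Definition kX : svar [:: 2] 2 := sv0 2 [::].

Fixpoint tilde m (p : gformula m) : kformula (Ln n) m [:: 2] :=
  match p with
  | gEq i j => kEq (kVar _ _ i) (kVar _ _ j)
  | gE i j => kAtom kX (kVar _ _ i) (kVar _ _ j)
  | gNot p => kNot (tilde p)
  | gAnd p q => kAnd (tilde p) (tilde q)
  | gOr p q => kOr (tilde p) (tilde q)
  | gAll p => kAll (kImp (klt (kVar _ _ ord0) (kn _ _ _)) (tilde p))
  | gEx p => kEx (kAnd (klt (kVar _ _ ord0) (kn _ _ _)) (tilde p))
  end.

Definition represents (F : set (Om -> M)) (GG : forall k, set (rfun k))
    (Gamma : rfun 2) :=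
  GG 2 Gamma /\ forall a b, vertices F a -> vertices F b ->
    let e := tnth [tuple a; b] in
    ktruth F GG (kAtom kX (kVar _ _ ord0) (kVar _ _ ord_max)) e (Gamma, tt) =
    wlim F (gE ord0 ord_max) e.

End Structures.

(* Main.v *)
Require Import Defs.
From mathcomp Require Import all_boot all_order generic_quotient finmap.
From mathcomp Require Import boolp classical_sets functions cardinality.
From Stdlib Require Reals Lra.

(** The identity is proved by induction on the formula, over environments of
    F-vertices. Atoms are the representation hypothesis, connectives are
    immediate, and the content lies in the quantifiers: the wide limit ranges
    over the F-vertices, whereas the relativized quantifier ranges over all of
    F and weights the instance at a by the truth value of a < n.

    Every a in F is matched with the vertex b that equals a where a < n and 0
    elsewhere ([restrict_vertex]); b exists because F has restrictable ranges
    and because n itself lies in M_n ([Mn_index]). Then a = b holds with truth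
    value at least that of a < n, so by the Leibniz law for the translated
    formulas ([tilde_Leibniz]) the instances at a and at b agree below the
    truth value of a < n. Hence the two families of truth values have the same
    upper (for the universal quantifier: lower) bounds.

    The Leibniz law is proved by induction too. On atoms it needs that the sets
    of samples on which two random variables agree are coded in M; this is
    definable separation, transferred from the natural numbers ([ext_sep]). On
    quantifiers it needs that c /\ sup x_i depends only on the elements
    c /\ x_i. In a Boolean algebra this holds as soon as the suprema exist, so
    it rests on the completeness of the algebra B ([supremums_BG]), which is
    where saturation enters: the supremum of a family is approximated in
    measure by finite joins, and a coded set that realizes countably many
    conditions on inclusion and cardinality is its least upper bound. *)

Set Implicit Arguments.
Unset Strict Implicit.
Unset Printing Implicit Defensive.

Import Order.Theory.
Local Open Scope classical_set_scope.
Local Open Scope quotient_scope.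

(** * The number n lies in M_n *)

Section Exponential.
Import Reals Lra.

(** With u = ln x the claim is u <= ln 2 * exp (u / t), which holds for
    u >= 8 t^2 since exp v >= v^2 / 4 and ln 2 >= 1 / 2. *)
Lemma le_pow_root_large (t : nat) : 0 < t ->
  exists N, forall x, N <= x -> le_pow_root x x t.
Proof.
move=> t0.
have t1 : (1 <= INR t)%R by apply: (le_INR 1); apply/ssrnat.leP.
have [N hN] := INR_unbounded (exp (8 * (INR t * INR t))).
exists N => x Nx; rewrite /le_pow_root.
have xbig : (exp (8 * (INR t * INR t)) < INR x)%R.
  by apply: (Rlt_le_trans _ _ _ hN); apply/le_INR/ssrnat.leP.
have x0 : (0 < INR x)%R by apply: Rlt_trans xbig; apply: exp_pos.
set u := ln (INR x).
have u8 : (8 * (INR t * INR t) < u)%R.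
  by apply: exp_lt_inv; rewrite /u exp_ln.
have ln2 : (1 / 2 <= ln 2)%R by have := ln_lt_2; lra.
set v := (/ INR t * u)%R.
have uE : u = (INR t * v)%R by rewrite /v; field; lra.
have v8 : (8 * INR t <= v)%R by nra.
(* exp v is the square of exp (v / 2), which is at least 1 + v / 2. *)
have hv : (v * v / 4 <= exp v)%R.
  have -> : v = (v / 2 + v / 2)%R by lra.
  rewrite exp_plus; have := exp_ineq1_le (v / 2); nra.
rewrite -[X in Rle X _](exp_ln _ x0) -/u /Rpower -/u -/v.
have -> : INR 2 = 2%R by [].
have le_exp (a b : R) : (a <= b)%R -> (exp a <= exp b)%R.
  by case=> [/exp_increasing/Rlt_le|->] //; apply: Rle_refl.
apply: le_exp; nra.
Qed.

End Exponential.

(** For standard t, x <= 2 ^ (x ^ (1 / t)) holds for all large x. So the largest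
    t <= x with this property tends to infinity with x, and its value at n is
    nonstandard. *)
Lemma Mn_index (M : true_model) (n : nonstd M) : Mn n n.
Proof.
pose le (x t : nat) := le_pow_root x x t.
pose root (x : nat) : nat := \max_(t < x.+1 | `[< le x t >]) t.
pose lt (x y : nat) : Prop := x < y.
pose v := Var L_all (@ord0 0).
have big k : Mlt (std k) (ap1 root n) /\ holds3 le_pow_root n n (ap1 root n).
  have [N hN] := le_pow_root_large (ltn0Sn k).
  suff: Mlt n (std (maxn N k.+1)) \/
      (Mlt (std k) (ap1 root n) /\ holds3 le_pow_root n n (ap1 root n)).
    by case=> // /nonstandard_gt => /(_ (@ns_nonstandard _ n)).
  apply: (@transferP M _ (fOr (fholds2 lt v (tstd 1 (maxn N k.+1)))
     (fAnd (fholds2 lt (tstd 1 k) (tap1 root v))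
       (fRel (rsym3 le_pow_root) (tnth [tuple v; v; tap1 root v]))))
    (fun S e => Mlt (e ord0) (std (maxn N k.+1)) \/
      (Mlt (std k) (ap1 root (e ord0)) /\
       holds3 le_pow_root (e ord0) (e ord0) (ap1 root (e ord0)))) _ _
    (tnth [tuple n : M])).
    move=> S e; rewrite sat_or sat_and !sat_holds2 teval1 !teval_std teval_var.
    congr (_ \/ (_ /\ _)); rewrite /holds3 /=; congr (rint _ _); apply/funext.
    case=> [[|[|[|//]]] ?] //; rewrite -[LHS]/(teval (tap1 root v) e).
    by rewrite teval1.
  move=> e; change (e ord0 < maxn N k.+1 \/
    (k < root (e ord0) /\ le_pow_root (e ord0) (e ord0) (root (e ord0)))).
  move: (e ord0 : nat) => x {e}; have [|] := ltnP x (maxn N k.+1); first by left.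
  rewrite geq_max => /andP[/hN hx kx]; right.
  have kx' : k.+1 < x.+1 by [].
  have hk : `[< le x (Ordinal kx') >] by apply/asboolP.
  split.
    exact: (@leq_bigmax_cond _ _ (fun t : 'I_x.+1 => t : nat) (Ordinal kx') hk).
  have [] := @eq_bigmax_cond _ [pred t : 'I_x.+1 | `[< le x t >]]
    (fun t => t : nat).
    by apply/card_gt0P; exists (Ordinal kx').
  by move=> t /asboolP ht; rewrite /root => ->.
exists (ap1 root n); split; last by have [] := big 0.
move=> k rk; have [+ _] := big k; rewrite rk.
suff: ~ Mlt (std k : M) (std k) by [].
apply: (@transferP M _ (fNot (fholds2 lt (tstd 1 k) (tstd 1 k)))
  (fun S e => ~ Mlt (std k : S) (std k)) _ _ (tnth [tuple n : M])).
  by move=> S e; rewrite sat_not sat_holds2 !teval_std.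
by move=> e; change (~ (k < k)); rewrite ltnn.
Qed.

Lemma Mlt0_nonstandard (M : true_model) (x : M) : nonstandard x -> Mlt (std 0) x.
Proof.
move=> nx; pose lt (x y : nat) : Prop := x < y; pose v := Var L_all (@ord0 0).
suff: Mlt (std 0) x \/ x = std 0 by case=> // /nx.
apply: (@transferP M _ (fOr (fholds2 lt (tstd 1 0) v) (fEq v (tstd 1 0)))
  (fun S e => Mlt (std 0) (e ord0) \/ e ord0 = std 0) _ _ (tnth [tuple x])).
  by move=> S e; rewrite sat_or sat_holds2 /sat teval_std.
move=> e; change (0 < e ord0 \/ e ord0 = 0).
by case: (e ord0 : nat); [right|left].
Qed.

(** * Definable sets of samples *)

Section Scons.
Variables (T : Type) (m : nat) (x : T) (e : 'I_m -> T).

Lemma scons0 : scons x e ord0 = x.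
Proof. by rewrite /scons unlift_none. Qed.

Lemma sconsS i : scons x e (lift ord0 i) = e i.
Proof. by rewrite /scons liftK. Qed.

Lemma scons_forall (P : T -> Prop) :
  P x -> (forall i, P (e i)) -> forall i, P (scons x e i).
Proof.
by move=> Px Pe i; case: (unliftP ord0 i) => [j|] ->; rewrite ?sconsS ?scons0.
Qed.

End Scons.

Lemma scons_eta (T : Type) m (e : 'I_m.+1 -> T) :
  scons (e ord0) (fun i => e (lift ord0 i)) = e.
Proof.
by apply/funext => i; case: (unliftP ord0 i) => [j|] ->; rewrite ?sconsS ?scons0.
Qed.

Section Separation.
Variable M : true_model.

Let mem (y d : nat) : Prop := y \in decode d.
Let satE := (sat_imp, sat_and, sat_or, sat_not, sat_holds2,
             teval1, teval2, teval_std, teval_var).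

(** In the standard model the subset of a finite set cut out by a formula is
    again finite, so some function symbol names a code of it. *)
Definition sep_sym m (p : formula L_all m.+1) (i : 'I_m) : Defs.fsym L_all m :=
  fun x => choice.pickle
    [fset w in decode (x i) | `[< sat (S := N_all) p (scons w x) >]]%fset.

(** Every subset of a coded set that is definable in M with parameters is
    coded: the defining property of the symbol above is transferred. *)
Lemma ext_sep m (p : formula L_all m.+1) i (e : 'I_m -> M) :
  ext (fint (sep_sym p i) e) = [set w | ext (e i) w /\ sat p (scons w e)].
Proof.
pose v0 := Var L_all (@ord0 m).
pose t := App (sep_sym p i) (fun j => Var L_all (lift ord0 j)).
pose l := fholds2 mem v0 t.
pose r := fAnd (fholds2 mem v0 (Var _ (lift ord0 i))) p.
have h : forall f : 'I_m.+1 -> M,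
    Mmem (f ord0) (fint (sep_sym p i) (fun j => f (lift ord0 j))) <->
    Mmem (f ord0) (f (lift ord0 i)) /\ sat p f.
  apply: (@transferP M _ (fAnd (fImp l r) (fImp r l)) (fun S f =>
      Mmem (f ord0) (fint (sep_sym p i) (fun j => f (lift ord0 j))) <->
      Mmem (f ord0) (f (lift ord0 i)) /\ sat p f)).
    by move=> S f; rewrite sat_and !satE.
  move=> f; rewrite -[X in sat p X]scons_eta.
  change (f ord0 \in decode (sep_sym p i (fun j => f (lift ord0 j))) <->
    f ord0 \in decode (f (lift ord0 i)) /\
    sat p (scons (f ord0) (fun j => f (lift ord0 j)))).
  rewrite pickleK_decode !inE; split=> [/andP[-> /asboolP]|[->]] //.
  by move/asboolP.
apply/funext => w; apply/propext; have := h (scons w e).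
by rewrite scons0 sconsS (_ : (fun j => _) = e) //; apply/funext => j; rewrite sconsS.
Qed.

(** Evaluation of the function whose graph is coded by c. *)
Definition look (c w : nat) : nat :=
  xget 0 [set y | choice.pickle (w, y) \in decode c].

Lemma lookP (c w y : M) : Mmem (Mpair w y) c -> Mmem (Mpair w (ap2 look c w)) c.
Proof.
pose pr (x y : nat) := choice.pickle (x, y).
pose i0 : 'I_3 := ord0; pose i1 : 'I_3 := Ordinal (isT : 1 < 3).
pose i2 : 'I_3 := ord_max; pose v := @Var L_all 3.
apply: (@transferP M _ (fImp (fholds2 mem (tap2 pr (v i1) (v i2)) (v i0))
    (fholds2 mem (tap2 pr (v i1) (tap2 look (v i0) (v i1))) (v i0)))
  (fun S e => Mmem (Mpair (e i1) (e i2)) (e i0) ->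
     Mmem (Mpair (e i1) (ap2 look (e i0) (e i1))) (e i0)) _ _
  (tnth [tuple c; w; y])).
  by move=> S e; rewrite !satE.
move=> e h.
pose Q : set nat := [set y : nat | choice.pickle (e i1 : nat, y) \in decode (e i0)].
have := @xgetPex _ 0 Q; apply; exists (e i2); exact: h.
Qed.

Lemma Mpair_inj (x y x' y' : M) : Mpair x y = Mpair x' y' -> x = x' /\ y = y'.
Proof.
pose pr (x y : nat) := choice.pickle (x, y).
pose i0 : 'I_4 := ord0; pose i1 : 'I_4 := Ordinal (isT : 1 < 4).
pose i2 : 'I_4 := Ordinal (isT : 2 < 4).
pose i3 : 'I_4 := ord_max; pose v := @Var L_all 4.
apply: (@transferP M _ (fImp (fEq (tap2 pr (v i0) (v i1)) (tap2 pr (v i2) (v i3)))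
    (fAnd (fEq (v i0) (v i2)) (fEq (v i1) (v i3))))
  (fun S e => Mpair (e i0) (e i1) = Mpair (e i2) (e i3) ->
     e i0 = e i2 /\ e i1 = e i3) _ _
  (tnth [tuple x; y; x'; y'])).
  by move=> S e; rewrite !satE /sat !satE.
by move=> e /(pcan_inj choice.pickleK)[].
Qed.

Variables (n : nonstd M) (G : wide_sequence).
Implicit Types a b : Gn n G -> M.

(** A random variable becomes a term in the sample, with its code as a
    parameter; definable separation therefore applies to conditions on its
    values. *)
Lemma random_variable_look a : random_variable a ->
  exists c : M, forall w, ap2 look c (set_val w) = a w.
Proof.
case=> c cE; exists c => w.
have /lookP : Mmem (Mpair (set_val w) (a w)) c.
  by rewrite -[Mmem _ _]/(ext c _) cE; exists w.
rewrite -[Mmem _ _]/(ext c _) cE => -[w' /Mpair_inj[/val_inj <-]].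
by [].
Qed.

Lemma Gcoded_sep m (p : formula L_all m.+2) (e : 'I_m -> M) :
  Gcoded [set w : Gn n G | sat p (scons (set_val w) (scons (Gcode n G) e))].
Proof.
exists (fint (sep_sym p ord0) (scons (Gcode n G) e)); rewrite ext_sep scons0.
apply/seteqP; split=> [x [xG px]|_ [w pw <-]]; last by split=> //; apply: (set_valP w).
by exists (SigSub (mem_set xG)).
Qed.

Lemma Gcoded_eq a b : random_variable a -> random_variable b ->
  Gcoded [set w | a w = b w].
Proof.
move=> /random_variable_look[c ac] /random_variable_look[d bd].
pose w0 := Var L_all (@ord0 3).
pose c0 := Var L_all (lift ord0 (lift ord0 (@ord0 1))).
pose d0 := Var L_all (lift ord0 (lift ord0 (@ord_max 1))).
have := Gcoded_sep (fEq (tap2 look c0 w0) (tap2 look d0 w0)) (tnth [tuple c; d]).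
congr Gcoded; apply/funext => w; rewrite /mkset {1}/sat !satE.
by rewrite scons0 !sconsS ac bd.
Qed.

Lemma Gcoded_lt a d : random_variable a -> Gcoded [set w | Mlt (a w) d].
Proof.
move=> /random_variable_look[c ac].
pose w0 := Var L_all (@ord0 3).
pose c0 := Var L_all (lift ord0 (lift ord0 (@ord0 1))).
pose d0 := Var L_all (lift ord0 (lift ord0 (@ord_max 1))).
have := Gcoded_sep (fholds2 (fun x y => x < y) (tap2 look c0 w0) d0)
  (tnth [tuple c; d]).
congr Gcoded; apply/funext => w; rewrite /mkset !satE.
by rewrite scons0 !sconsS ac.
Qed.

End Separation.

(** * Completeness of the algebra of truth values *)

Section Completeness.
Variable M : true_model.

Let mem (y d : nat) : Prop := y \in decode d.
Let lt (x y : nat) : Prop := x < y.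
Let card (d : nat) := #|` decode d|.
Let satE := (sat_imp, sat_and, sat_or, sat_not, sat_holds2,
             teval1, teval2, teval_std, teval_var).

(** The step that turns near-maximality of x into a bound on what b adds to it:
    if |x| / g is at least j / k and |x u b| / g is less than (j + 1) / k,
    then |b \ x| / g is less than 1 / k. *)
Lemma card_setD_ratio (x b g : M) k j :
  Mlt (ap2 muln (std k) (Mcard (ap2 (fset_op fsetU) x b))) (ap2 muln (std j.+1) g) ->
  ~ Mlt (ap2 muln (std k) (Mcard x)) (ap2 muln (std j) g) ->
  Mlt (ap2 muln (std k) (Mcard (ap2 (fset_op fsetD) b x))) g.
Proof.
pose i0 : 'I_3 := ord0; pose i1 : 'I_3 := Ordinal (isT : 1 < 3).
pose i2 : 'I_3 := ord_max; pose v := @Var L_all 3.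
pose f j t := fholds2 lt (tap2 muln (tstd 3 k) (tap1 card t))
  (tap2 muln (tstd 3 j) (v i2)).
pose f' t := fholds2 lt (tap2 muln (tstd 3 k) (tap1 card t)) (v i2).
apply: (@transferP M _ (fImp (f j.+1 (tap2 (fset_op fsetU) (v i0) (v i1)))
    (fImp (fNot (f j (v i0))) (f' (tap2 (fset_op fsetD) (v i1) (v i0)))))
  (fun S e =>
  Mlt (ap2 muln (std k) (Mcard (ap2 (fset_op fsetU) (e i0) (e i1))))
    (ap2 muln (std j.+1) (e i2)) ->
  ~ Mlt (ap2 muln (std k) (Mcard (e i0))) (ap2 muln (std j) (e i2)) ->
  Mlt (ap2 muln (std k) (Mcard (ap2 (fset_op fsetD) (e i1) (e i0)))) (e i2))
  _ _ (tnth [tuple x; b; g])).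
  by move=> S e; rewrite !satE.
move=> e; change (k * card (fset_op fsetU (e i0) (e i1)) < j.+1 * e i2 ->
  ~ k * card (e i0) < j * e i2 -> k * card (fset_op fsetD (e i1) (e i0)) < e i2).
rewrite /card !pickleK_decode => + /negP; rewrite -leqNgt.
have <- : #|` decode (e i0)| + #|` fsetD (decode (e i1)) (decode (e i0))| =
    #|` fsetU (decode (e i0)) (decode (e i1))|.
  have -> : fsetU (decode (e i0)) (decode (e i1)) =
      fsetU (decode (e i0)) (fsetD (decode (e i1)) (decode (e i0))).
    by apply/fsetP => z; rewrite !inE; case: (z \in decode (e i0)).
  rewrite -[RHS]addn0 -(cardfs0 nat) -[X in _ = _ + #|`X|](_ : fsetI (decode (e i0))
    (fsetD (decode (e i1)) (decode (e i0))) = _) ?cardfsUI //.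
  by apply/fsetP => z; rewrite !inE; case: (z \in decode (e i0)).
rewrite mulnDr mulSn (addnC (e i2)) => h1 h2.
by rewrite -(ltn_add2l (j * e i2)); apply: leq_ltn_trans h1; rewrite leq_add2r.
Qed.

Lemma ltn0_mul (y g : M) : ~ Mlt y (ap2 muln (std 0) g).
Proof.
pose v := @Var L_all 2.
apply: (@transferP M _
  (fNot (fholds2 lt (v ord0) (tap2 muln (tstd 2 0) (v ord_max))))
  (fun S e => ~ Mlt (e ord0) (ap2 muln (std 0) (e ord_max))) _ _
  (tnth [tuple y; g])).
  by move=> S e; rewrite !satE.
by move=> e; change (~ (e ord0 < 0 * e ord_max)); rewrite mul0n ltn0.
Qed.

Lemma ltn_mulS (g : M) k : Mlt (std 0) g ->
  Mlt (ap2 muln (std k) g) (ap2 muln (std k.+1) g).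
Proof.
pose v := Var L_all (@ord0 0).
apply: (@transferP M _ (fImp (fholds2 lt (tstd 1 0) v)
    (fholds2 lt (tap2 muln (tstd 1 k) v) (tap2 muln (tstd 1 k.+1) v)))
  (fun S e => Mlt (std 0) (e ord0) ->
    Mlt (ap2 muln (std k) (e ord0)) (ap2 muln (std k.+1) (e ord0))) _ _
  (tnth [tuple g])).
  by move=> S e; rewrite !satE.
move=> e; change (0 < e ord0 -> k * e ord0 < k.+1 * e ord0).
by move=> e0; rewrite mulSn addnC -[X in X < _]addn0 ltn_add2l.
Qed.

Variables (n : nonstd M) (G : wide_sequence).
Let B := BG n G.
Let g : M := Mcard (Gcode n G).

(** Measure below 1 / k. A set has many codes, and any of them may witness it;
    the cardinality does not depend on the code. *)
Definition small (k : nat) (X : set (Gn n G)) :=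
  exists a, ext a = set_val @` X /\ Mlt (ap2 muln (std k) (Mcard a)) g.

Lemma small_sub k X Y : Gcoded X -> X `<=` Y -> small k Y -> small k X.
Proof.
move=> [a aX] XY [b [bY hb]]; exists a; split=> //.
by apply: card_sub_ratio hb; rewrite aX bY; apply: image_subset.
Qed.

Lemma smallU k X Y : small (2 * k) X -> small (2 * k) Y -> small k (X `|` Y).
Proof.
case=> a [aX ha] [b [bY hb]]; exists (ap2 (fset_op fsetU) a b).
by rewrite ext_setU aX bY image_setU; split=> //; apply: card_setU_ratio.
Qed.

Lemma negligibleP X : negligible X <-> forall k, 0 < k -> small k X.
Proof.
split=> [[a [aX ha]] k /ha|h]; first by exists a.
have [a [aX _]] := h 1 isT; exists a; split=> // k /h[b [bX hb]].
by apply: card_sub_ratio hb; rewrite aX bX.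
Qed.

Lemma pi_le (X Y : coded_subset n G) :
  (\pi_B X <= \pi_B Y)%O <-> negligible (cs_set X `\` cs_set Y).
Proof.
have -> : cs_set X `\` cs_set Y = cs_set (csI X Y) `+` cs_set X.
  by apply/seteqP; split=> w /=; rewrite /setY /setD /setU /setI /=; tauto.
rewrite -[(_ <= _)%O]/(bmeet _ _ == _) -pi_bmeet.
by split=> [/cs_eqP|/cs_eqP].
Qed.

Definition code (X : coded_subset n G) : M := projT1 (cid (cs_coded X)).

Lemma ext_code X : ext (code X) = set_val @` cs_set X.
Proof. by rewrite /code; case: cid. Qed.

(** Measure below j / k, with denominators cleared. *)
Definition below (k j : nat) (X : coded_subset n G) :=
  Mlt (ap2 muln (std k) (Mcard (code X))) (ap2 muln (std j) g).

Lemma small_setD k j X Y : below k j.+1 (csU X Y) -> ~ below k j X ->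
  small k (cs_set Y `\` cs_set X).
Proof.
move=> hU hX; exists (ap2 (fset_op fsetD) (code Y) (code X)); split.
  by rewrite ext_setD !ext_code val_image_setD.
apply: card_setD_ratio hX; apply: card_sub_ratio hU.
by rewrite ext_setU !ext_code image_setU.
Qed.

Definition joins (l : seq (coded_subset n G)) := foldr (@csU _ _ _) (cs0 n G) l.

Lemma joinsP l w : cs_set (joins l) w <-> exists2 X, X \in l & cs_set X w.
Proof.
elim: l => [|X l IH] /=; first by split=> // -[].
split=> [[Xw|/IH[Y Yl Yw]]|[Y]].
- by exists X => //; rewrite mem_head.
- by exists Y => //; rewrite inE Yl orbT.
- by rewrite inE => /orP[/eqP ->|Yl Yw]; [left|right; apply/IH; exists Y].
Qed.

Lemma ex_last (P : nat -> Prop) m : P 0 -> ~ P m -> exists j, P j /\ ~ P j.+1.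
Proof.
move=> P0; elim: m => // m IH nPm; have [Pm|/IH//] := pselect (P m).
by exists m.
Qed.

(** For each k there is a j_k such that some finite join X_k of elements of S
    has measure at least j_k / k while every finite join has measure below
    (j_k + 1) / k; so adding further elements of S to X_k increases the measure
    by less than 1 / k. By saturation there is a coded set A that includes all
    X_k and has measure below (j_k + 1) / k for all k, the finite joins of the
    X_k showing that these conditions are finitely satisfiable. An element of S
    exceeds A by less than 1 / k for each k, as it exceeds X_k by less than
    that, so A is an upper bound. Likewise A exceeds X_k by less than 1 / k, and
    X_k lies below every upper bound, so A is the least one. *)
Lemma supremums_BG (S : set B) : supremums S !=set0.
Proof.
pose ok (l : seq (coded_subset n G)) := forall X, X \in l -> S (\pi_B X).
have step k : exists jl, [/\ ok jl.2, ~ below k jl.1 (joins jl.2) &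
    forall l, ok l -> below k jl.1.+1 (joins l)].
  have [||j [[l okl hl] hj]] :=
      @ex_last (fun j => exists2 l, ok l & ~ below k j (joins l)) k.+1.
  - by exists [::] => //; apply: ltn0_mul.
  (* no subset of Gn has measure (k + 1) / k *)
  - case=> l _; apply; apply: (card_sub_ratio (b := Gcode n G)).
      by rewrite ext_code => _ [w _ <-]; apply: (set_valP w).
    exact/ltn_mulS/card_family_gt0/ns_nonstandard.
  exists (j, l); split=> // l' okl'; apply: contrapT => h.
  by apply: hj; exists l'.
have [jl hjl] := choice step.
pose X k := joins (jl k).2; pose j k := (jl k).1.
(* The type of A: the formula phi k, in which the variable 0 is A and the
   other two are replaced by codes of X k and of Gn. *)
pose va := Var L_all (@ord0 2).
pose x := Var L_all (@ord0 3).
pose up (i : 'I_3) := Var L_all (lift (@ord0 3) i).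
pose iX : 'I_3 := lift ord0 ord0; pose iG : 'I_3 := lift ord0 ord_max.
pose phi k :=
  fAnd (fAll (fImp (fholds2 mem x (up iX)) (fholds2 mem x (up ord0))))
  (fAnd (fAll (fImp (fholds2 mem x (up ord0)) (fholds2 mem x (up iG))))
     (fholds2 lt (tap2 muln (tstd 3 k) (tap1 card va))
       (tap2 muln (tstd 3 (j k).+1) (tap1 card (Var _ iG))))).
pose q k : pformula M :=
  @PFormula _ M 2 (phi k) (tnth [tuple code (X k); Gcode n G]).
have sub (i i' : 'I_3) (e : 'I_3 -> M) :
    sat (fAll (fImp (fholds2 mem x (up i)) (fholds2 mem x (up i')))) e =
    (ext (e i) `<=` ext (e i')).
  have E w : sat (fImp (fholds2 mem x (up i)) (fholds2 mem x (up i'))) (scons w e) =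
      (ext (e i) w -> ext (e i') w).
    by rewrite !satE scons0 !sconsS.
  transitivity (forall w, sat (fImp (fholds2 mem x (up i)) (fholds2 mem x (up i')))
    (scons w e)); first by [].
  by apply/propext; split=> h w; [rewrite -E|rewrite E]; apply: h.
have qE k a : pf_holds (q k) a = [/\ ext (code (X k)) `<=` ext a,
    ext a `<=` ext (Gcode n G) &
    Mlt (ap2 muln (std k) (Mcard a)) (ap2 muln (std (j k).+1) g)] :> Prop.
  rewrite -[LHS]/(sat (phi k) (scons a (tnth [tuple code (X k); Gcode n G]))).
  rewrite /phi !sat_and !sub !satE !sconsS scons0.
  by apply/propext; split=> [[? []]|[]].
have [a ha] : exists a, forall r, range q r -> pf_holds r a.
  apply: (tm_saturated
    (A := range (fun k => if k is k'.+1 then code (X k') else Gcode n G))).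
  - exact: card_image_le.
  - move=> _ [k _ <-] /= [[|[|//]] ?]; [by exists k.+1|by exists 0].
  - move=> p0 fp0 sp0.
    pose f r := xget 0 [set k | q k = r].
    have qf r : p0 r -> q (f r) = r.
      by move=> /sp0[k _ kr]; apply: (@xgetPex _ 0 [set k | q k = r]); exists k.
    have [K hK] : exists K, forall r, p0 r -> f r < K.
      have /finite_fsetP[D fD] := finite_image f fp0.
      exists (\max_(k <- D) k).+1 => r p0r; rewrite ltnS.
      have : [set` D] (f r) by rewrite -fD; exists r.
      by move=> fr; apply: (@leq_bigmax_seq _ _ predT id).
    pose L := flatten [seq (jl k).2 | k <- iota 0 K].
    exists (code (joins L)) => r p0r; rewrite -(qf r p0r) qE; split.
    + rewrite !ext_code; apply: image_subset => w /joinsP[Y Yl Yw]; apply/joinsP.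
      exists Y => //; apply/flattenP; exists (jl (f r)).2 => //.
      by apply: map_f; rewrite mem_iota /= hK.
    + by rewrite ext_code => _ [w _ <-]; apply: (set_valP w).
    + have [_ _] := hjl (f r); apply=> Y /flattenP[_ /mapP[k _ ->]].
      by have [+ _ _] := hjl k; apply.
have {}ha k : [/\ ext (code (X k)) `<=` ext a, ext a `<=` ext (Gcode n G) &
    Mlt (ap2 muln (std k) (Mcard a)) (ap2 muln (std (j k).+1) g)].
  by rewrite -qE; apply: ha; exists k.
have aG : ext a `<=` Gn n G by have [] := ha 0.
have cA : Gcoded [set w : Gn n G | ext a (set_val w)].
  exists a; apply/seteqP; split=> [y ay|_ [w aw <-]] //.
  by exists (SigSub (mem_set (aG _ ay))).
pose A := CodedSubset cA.
have XA k : cs_set (X k) `<=` cs_set A.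
  by move=> w Xw; have [+ _ _] := ha k; apply; rewrite ext_code; exists w.
exists (\pi_B A); split.
- elim/quotW => Y SY; apply/pi_le/negligibleP => k k0.
  have [okl lej ltj] := hjl k.
  apply: (@small_sub _ _ (cs_set Y `\` cs_set (X k))).
  + by apply: GcodedD; apply: cs_coded.
  + by move=> w [Yw nAw]; split=> // /XA.
  apply: small_setD lej.
  have := ltj (Y :: (jl k).2); rewrite /joins /= -/(joins _).
  have -> : csU Y (joins (jl k).2) = csU (X k) Y by apply: cs_setP; apply: setUC.
  by apply=> Z; rewrite inE => /orP[/eqP ->|/okl].
- elim/quotW => V ubV; apply/pi_le/negligibleP => k k0.
  (* two errors below 1 / (2 k) add up to one below 1 / k *)
  pose k2 := 2 * k; have [okl lej ltj] := hjl k2.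
  apply: (@small_sub _ _
    ((cs_set A `\` cs_set (X k2)) `|` (cs_set (X k2) `\` cs_set V))).
  + by apply: GcodedD; apply: cs_coded.
  + by move=> w [Aw nVw]; have [Xw|nXw] := pselect (cs_set (X k2) w); [right|left].
  apply: smallU.
  + apply: small_setD lej; have [_ _] := ha k2; apply: card_sub_ratio.
    by rewrite ext_code => _ [w [/XA|] + <-].
  + suff /pi_le/negligibleP : (\pi_B (X k2) <= \pi_B V)%O by apply; rewrite muln_gt0.
    rewrite /X; elim: (jl k2).2 okl => [_|Y l IH okl]; first exact: ble0x.
    rewrite /= pi_bjoin -[bjoin _ _]/(Order.join _ _) leUx IH ?andbT.
      by apply: ubV; apply: okl; rewrite mem_head.
    by move=> Z Zl; apply: okl; rewrite inE Zl orbT.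
Qed.

End Completeness.

Section CompleteAlgebra.
Variables (M : true_model) (n : nonstd M) (G : wide_sequence).
Implicit Types (b c d : BG n G) (A : set (BG n G)).

Lemma bigjoinP A b : (bigjoin A <= b)%O <-> ubound A b.
Proof.
have [s hs] := supremums_BG A; rewrite /bigjoin /supremum.
have [->|_] := eqVneq A set0; first by rewrite le0x; split=> // _ x.
case: xgetP => [_ -> [uA lA]|/(_ s) //].
split=> [le x Ax|/lA //]; exact: le_trans (uA x Ax) le.
Qed.

Lemma bigmeetP A b : (b <= bigmeet A)%O <-> lbound A b.
Proof.
have [s [us ls]] := supremums_BG [set (~` x)%O | x in A].
have hs : infimums A (~` s)%O.
  split=> [x Ax|x lx]; first by rewrite leCx; apply: us; exists x.
  by rewrite lexC; apply: ls => _ [y Ay <-]; rewrite leC; apply: lx.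
rewrite /bigmeet /infimum.
have [->|_] := eqVneq A set0; first by rewrite lex1; split=> // _ x.
case: xgetP => [_ -> [lA uA]|/(_ _ hs) //].
split=> [le x Ax|/uA //]; exact: le_trans le (lA x Ax).
Qed.

Lemma le_bigjoin A b : A b -> (b <= bigjoin A)%O.
Proof. by move=> Ab; apply: (bigjoinP A (bigjoin A)).1. Qed.

Lemma bigmeet_le A b : A b -> (bigmeet A <= b)%O.
Proof. by move=> Ab; apply: (bigmeetP A (bigmeet A)).1. Qed.

Lemma le_meetLR b c d : (c `&` b <= d)%O = (b <= ~` c `|` d)%O.
Proof. by rewrite -leBLR diffE complK meetC. Qed.

Lemma eq_meet c b d : (c `&` b <= d)%O -> (c `&` d <= b)%O -> (c `&` b = c `&` d)%O.
Proof. by move=> h1 h2; apply: le_anti; rewrite !lexI !leIl h1 h2. Qed.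

Lemma eq_meet_le c b d : (c `&` b = c `&` d)%O -> (c `&` b <= d)%O.
Proof. by move=> ->; apply: leIr. Qed.

Lemma eq_meet_compl c b d : (c `&` b = c `&` d)%O -> (c `&` ~` b = c `&` ~` d)%O.
Proof.
have h (u v : BG n G) : (c `&` v <= u)%O -> (c `&` ~` u <= ~` v)%O.
  by move=> vu; rewrite le_meetLR -complI leC.
by move=> E; apply: eq_meet; apply: h; apply: eq_meet_le.
Qed.

Section BigOps.
Variables (T : Type) (D : set T) (c : BG n G) (f g : T -> BG n G).
Hypothesis fg : forall x, D x -> (c `&` f x = c `&` g x)%O.

(** Joins of families that agree below c agree below c. This is where the
    suprema have to exist: a join that is only a default value carries no
    information about its family. *)
Lemma eq_meet_bigjoin :
  (c `&` bigjoin [set f x | x in D] = c `&` bigjoin [set g x | x in D])%O.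
Proof.
have h (u v : T -> BG n G) : (forall x, D x -> c `&` u x = c `&` v x)%O ->
    (c `&` bigjoin [set u x | x in D] <= bigjoin [set v x | x in D])%O.
  move=> uv; rewrite le_meetLR; apply/bigjoinP.
  move=> _ [x Dx <-]; rewrite -le_meetLR uv //; apply: le_trans (leIr _ _) _.
  by apply: le_bigjoin; exists x.
by apply: eq_meet; apply: h => // x /fg.
Qed.

Lemma eq_meet_bigmeet :
  (c `&` bigmeet [set f x | x in D] = c `&` bigmeet [set g x | x in D])%O.
Proof.
have h (u v : T -> BG n G) : (forall x, D x -> c `&` u x = c `&` v x)%O ->
    (c `&` bigmeet [set u x | x in D] <= bigmeet [set v x | x in D])%O.
  move=> uv; apply/bigmeetP.
  move=> _ [x Dx <-]; apply: le_trans (eq_meet_le (uv x Dx)).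
  by apply: leI2 => //; apply: bigmeet_le; exists x.
by apply: eq_meet; apply: h => // x /fg.
Qed.

End BigOps.
End CompleteAlgebra.

(** * Leibniz law and the comparison of truth values *)

Section TruthValues.
Variables (M : true_model) (n : nonstd M) (G : wide_sequence).
Implicit Types X Y Z : set (Gn n G).

Lemma clsE X (cX : Gcoded X) : cls X = \pi_(BG n G) (CodedSubset cX).
Proof.
rewrite /cls; case: pselect => // cX'.
by congr (\pi_(BG n G) _); apply: cs_setP.
Qed.

Lemma clsI X Y : Gcoded X -> Gcoded Y -> (cls X `&` cls Y = cls (X `&` Y))%O.
Proof.
move=> cX cY; rewrite (clsE cX) (clsE cY) (clsE (GcodedI cX cY)).
rewrite -[LHS]/(bmeet _ _) -pi_bmeet.
by congr (\pi_(BG n G) _); apply: cs_setP.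
Qed.

Lemma clsT : cls [set: Gn n G] = \top%O.
Proof. by rewrite (clsE (@GcodedT _ _ _)). Qed.

Lemma eq_meet_cls (c : BG n G) X Y Z : Gcoded X -> Gcoded Y -> Gcoded Z ->
  (c <= cls Z)%O -> Z `&` X = Z `&` Y -> (c `&` cls X = c `&` cls Y)%O.
Proof.
by move=> cX cY cZ /meet_l <- XY; rewrite -!meetA !clsI // XY.
Qed.

Variables (F : set (Gn n G -> M)) (GG : forall k : nat, set (rfun n G k)).
Variable Gamma : rfun n G 2.
Hypotheses (F_random : rv_family F) (F_closed : Ln_closed F)
  (F_ranges : restrictable_ranges F)
  (GG_compatible : compatible F GG) (Gamma_GG : GG Gamma).

Let K m (p : gformula m) e :=
  ktruth F GG (tilde n p) e ((Gamma, tt) : senv (rfun n G) [:: 2]).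

Lemma F_zero : F (fun=> std 0).
Proof.
have := @F_closed 0 (Ln_zero n) (fun _ _ => std 0)
  (fun i => match notF (ltn_ord i) with end).
congr F; apply/funext => w; rewrite /std /=; congr fint; apply/funext => -[] //.
Qed.

Definition agree m (c : BG n G) (e e' : 'I_m -> Gn n G -> M) :=
  forall i, (c <= cls [set w | e i w = e' i w])%O.

Lemma le_cls_refl (c : BG n G) (a : Gn n G -> M) : (c <= cls [set w | a w = a w])%O.
Proof. by rewrite (_ : mkset _ = setT) ?clsT ?lex1 //; apply/seteqP; split. Qed.

Lemma agree_scons m c a a' (e e' : 'I_m -> Gn n G -> M) :
  (c <= cls [set w | a w = a' w])%O -> agree c e e' ->
  agree c (scons a e) (scons a' e').
Proof.
by move=> ca ce i; case: (unliftP ord0 i) => [j|] ->; rewrite ?sconsS ?scons0.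
Qed.

Lemma ktruth_atom m (e : 'I_m -> Gn n G -> M) i j :
  ktruth F GG (kAtom (kX : svar [:: 2] 2) (kVar (Ln n) _ i) (kVar _ _ j)) e (Gamma, tt)
  = (~` cls [set w | rapp Gamma (tnth [tuple e i; e j]) w = std 0])%O.
Proof.
rewrite /=; congr (~` cls _)%O; apply/funext => w; congr (_ = _).
  by congr (rapp _ _ _); apply/funext; case=> [[|[|//]] ?].
by rewrite /std; congr fint; apply/funext => -[].
Qed.

Lemma ktruth_lt m (e : 'I_m -> Gn n G -> M) i s :
  ktruth F GG (klt (kVar (Ln n) [:: 2] i) (kn _ _ _)) e s =
  cls [set w | Mlt (e i w) n].
Proof.
rewrite /=; congr cls; apply/funext => w; rewrite /mkset /Mlt /holds2.
by congr (rint _ _); apply/funext; case=> [[|[|//]] ?].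
Qed.

Lemma ktruth_all m (p : gformula m.+1) e :
  K (gAll p) e =
  bigmeet [set (~` cls [set w | Mlt (a w) n] `|` K p (scons a e))%O | a in F].
Proof.
rewrite /K /= -/(ktruth _ _ _ _ _); congr bigmeet; congr image; apply/funext => a.
by congr (~` _ `|` _)%O; have := ktruth_lt (scons a e) ord0 (Gamma, tt); rewrite scons0.
Qed.

Lemma ktruth_ex m (p : gformula m.+1) e :
  K (gEx p) e =
  bigjoin [set (cls [set w | Mlt (a w) n] `&` K p (scons a e))%O | a in F].
Proof.
rewrite /K /= -/(ktruth _ _ _ _ _); congr bigjoin; congr image; apply/funext => a.
by congr (_ `&` _)%O; have := ktruth_lt (scons a e) ord0 (Gamma, tt); rewrite scons0.
Qed.

(** The Leibniz law, for environments in all of F: the bounded quantifiers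
    evaluate their scope also at elements that are not vertices, and the
    representation hypothesis says nothing about Gamma there. *)
Lemma tilde_Leibniz m (p : gformula m) c (e e' : 'I_m -> Gn n G -> M) :
  (forall i, F (e i)) -> (forall i, F (e' i)) -> agree c e e' ->
  (c `&` K p e = c `&` K p e')%O.
Proof.
elim: m / p e e' => [m i j|m i j|m p IH|m p IHp q IHq|m p IHp q IHq|m p IH|
  m p IH] e e' Fe Fe' ce.
1,2: have cE k := Gcoded_eq (F_random (Fe k)) (F_random (Fe' k)).
1,2: have cZ :
    (c <= cls ([set w | e i w = e' i w] `&` [set w | e j w = e' j w]))%O
  by rewrite -clsI // lexI !ce.
- rewrite /K /=; apply: eq_meet_cls cZ _ => //.
  + by apply: Gcoded_eq; apply: F_random.
  + by apply: Gcoded_eq; apply: F_random.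
  + exact: GcodedI.
  + apply/seteqP; split=> w [[wi wj] ww]; split=> //;
      move: wi wj ww; rewrite /mkset; congruence.
- have FG (f : 'I_m -> Gn n G -> M) : (forall k, F (f k)) ->
      Gcoded [set w | rapp Gamma (tnth [tuple f i; f j]) w = std 0].
    move=> Ff; apply: Gcoded_eq; apply: F_random; last exact: F_zero.
    by apply: GG_compatible => //; case=> [[|[|//]] ?]; apply: Ff.
  rewrite /K !ktruth_atom; apply: eq_meet_compl; apply: eq_meet_cls cZ _.
  + exact: FG.
  + exact: FG.
  + exact: GcodedI.
  + have E w : e i w = e' i w -> e j w = e' j w ->
        rapp Gamma (tnth [tuple e i; e j]) w =
        rapp Gamma (tnth [tuple e' i; e' j]) w.
      move=> wi wj; rewrite /rapp; congr (odflt _ (Gamma w _)); apply/funext.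
      by case=> [[|[|//]] ?].
    by apply/seteqP; split=> w [[/= wi wj]]; rewrite E.
- exact/eq_meet_compl/IH.
- rewrite /K /= meetA -/(K p e) (IHp e e') // -meetA meetCA.
  by rewrite -/(K q e) (IHq e e') // meetCA meetA.
- rewrite /K /= !meetUr -/(K p e) -/(K q e).
  by rewrite (IHp e e') // (IHq e e').
- rewrite !ktruth_all; apply: eq_meet_bigmeet => a Fa.
  rewrite !meetUr; congr (_ `|` _)%O.
  apply: IH; try exact: scons_forall.
  exact: agree_scons (le_cls_refl _ _) ce.
- rewrite !ktruth_ex; apply: eq_meet_bigjoin => a Fa.
  rewrite meetCA [RHS]meetCA; congr (_ `&` _)%O.
  apply: IH; try exact: scons_forall.
  exact: agree_scons (le_cls_refl _ _) ce.
Qed.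

Lemma restrict_vertex a : F a -> exists2 b, vertices F b &
  (cls [set w | Mlt (a w) n] <= cls [set w | a w = b w])%O.
Proof.
move=> Fa; have [b Fb ab] := F_ranges Fa (Mn_index n); exists b.
  split=> // w; have [lt_an gt_an] := ab w.
  have [an|an] := pselect (Mlt (a w) n); first by rewrite lt_an.
  by rewrite gt_an //; apply/Mlt0_nonstandard/ns_nonstandard.
have cab := Gcoded_eq (F_random Fa) (F_random Fb).
have cn := Gcoded_lt n (F_random Fa).
apply/meet_idPl; rewrite clsI //; congr cls.
by apply/seteqP; split=> [w []//|w an]; split=> //; have [/(_ an)] := ab w.
Qed.

Lemma cls_vertex_lt a : vertices F a -> cls [set w | Mlt (a w) n] = \top%O.
Proof.
case=> _ an; rewrite (_ : mkset _ = setT) ?clsT //.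
by apply/seteqP; split=> // w _; apply: an.
Qed.

Lemma restrict_tilde m (p : gformula m.+1) a e : F a -> (forall i, F (e i)) ->
  exists2 b, vertices F b &
    (cls [set w | Mlt (a w) n] `&` K p (scons a e) =
     cls [set w | Mlt (a w) n] `&` K p (scons b e))%O.
Proof.
move=> Fa Fe; have [b Vb ab] := restrict_vertex Fa; exists b => //.
have [Fb _] := Vb; apply: tilde_Leibniz; try exact: scons_forall.
by apply: agree_scons ab _ => i; apply: le_cls_refl.
Qed.

Hypothesis edges : forall a b, vertices F a -> vertices F b ->
  (~` cls [set w | rapp Gamma (tnth [tuple a; b]) w = std 0])%O =
  cls [set w | edge w (a w) (b w)].

(** Bounds of the family indexed by the vertices and of the one indexed by F
    coincide: at a vertex a the bound a < n has value \top, and an arbitrary a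
    is replaced by its restriction to values below n. *)
Lemma wlim_tilde m (p : gformula m) e : (forall i, vertices F (e i)) ->
  wlim F p e = K p e.
Proof.
elim: m / p e => [m i j|m i j|m p IH|m p IHp q IHq|m p IHp q IHq|m p IH|
  m p IH] e Ve.
- by [].
- by rewrite /K ktruth_atom edges.
- by rewrite /K /= IH.
- by rewrite /K /= IHp // IHq.
- by rewrite /K /= IHp // IHq.
- have Fe i : F (e i) by case: (Ve i).
  have IHe a : vertices F a -> wlim F p (scons a e) = K p (scons a e).
    by move=> Va; apply: IH; apply: scons_forall.
  rewrite ktruth_all /=; apply: le_anti; apply/andP; split; apply/bigmeetP.
  + move=> _ [a Fa <-]; rewrite -le_meetLR.
    have [b Vb ab] := restrict_tilde p Fa Fe.
    apply: le_trans (eq_meet_le (esym ab)); apply: leI2 => //.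
    by rewrite -IHe //; apply: bigmeet_le; exists b.
  + move=> _ [a Va <-]; rewrite IHe //; have [Fa _] := Va.
    apply: bigmeet_le; exists a => //.
    by rewrite cls_vertex_lt // compl1 join0x.
- have Fe i : F (e i) by case: (Ve i).
  have IHe a : vertices F a -> wlim F p (scons a e) = K p (scons a e).
    by move=> Va; apply: IH; apply: scons_forall.
  rewrite ktruth_ex /=; apply: le_anti; apply/andP; split; apply/bigjoinP.
  + move=> _ [a Va <-]; rewrite IHe //; have [Fa _] := Va.
    apply: le_bigjoin; exists a => //.
    by rewrite cls_vertex_lt // meet1x.
  + move=> _ [a Fa <-].
    have [b Vb ->] := restrict_tilde p Fa Fe.
    by apply: le_trans (leIr _ _) _; rewrite -IHe //; apply: le_bigjoin; exists b.
Qed.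

End TruthValues.

Theorem theorem4p8 (M : true_model) (n : nonstd M) (G : wide_sequence)
    (F : set (Gn n G -> M)) (GG : forall k : nat, set (rfun n G k))
    (Gamma : rfun n G 2) (phi : gformula 0)
    (F_random : rv_family F)
    (F_values : values_in_Mn F)
    (F_closed : Ln_closed F)
    (F_ranges : restrictable_ranges F)
    (GG_random : rfun_family GG)
    (GG_compatible : compatible F GG)
    (Gamma_edges : represents F GG Gamma) :
  wlim F phi (tnth [tuple]) =
  ktruth F GG (tilde n phi) (tnth [tuple]) (Gamma, tt).
Proof.
have [GGamma edges] := Gamma_edges.
apply: wlim_tilde => // [a b Va Vb|[]//].
rewrite -(ktruth_atom F GG Gamma (tnth [tuple a; b]) ord0 ord_max).
exact: edges.
Qed.
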